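(* Let $k\ge2$, let $Q(t)=t^{k+1}+a_kt^k+\cdots+a_0$ be a monic complex polynomial of degree $k+1$, and consider the curve $\mathcal X_t:\ y^k=\frac{z-t}{Q(z)}$ and the differential $\eta_t=(z-t)^{1/k-1}Q(z)^{-1/k}\,dz$. Let $\gamma$ be a locally constant cycle on $\mathcal X_t$ and set $I_\gamma(t)=\int_\gamma\eta_t$. Put $\alpha=(k-1)/k$. Then $I_\gamma$ satisfies the order-$k$ linear equation $$\mathcal L_kI_\gamma=0,\qquad \mathcal L_k=\sum_{j=0}^k\frac{k+1-j}{j!\,(\alpha)_{k-j}}\,Q^{(j)}(t)\frac{d^{k-j}}{dt^{k-j}},$$ where $(\alpha)_m$ is the Pochhammer symbol.
   Context: $(\alpha)_m=\alpha(\alpha+1)\cdots(\alpha+m-1)$, $(\alpha)_0=1$. A locally constant cycle $\gamma$ is a closed cycle on the cyclic cover $\mathcal X_t$ of the $z$-plane, avoiding the points over $z=t$ and over the zeros of $Q$, which is kept fixed (as a path in the $z$-plane together with a continuous single-valued choice of branch of $(z-t)^{1/k-1}Q(z)^{-1/k}$ along it) as $t$ varies in a small open set of values with $Q(t)\ne0$. *)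

(* Defs.v *)
From Stdlib Require Import Reals List ZArith Lra Lia.
From Coquelicot Require Import Coquelicot.

Open Scope C_scope.

Definition monic_poly (k : nat) (a : nat -> C) (z : C) : C :=
  z ^ (k + 1) + sum_n (G := C_AbelianMonoid) (fun i => a i * z ^ i) k.

(* The affine points (z, y) of X_t lying over points z with Q z <> 0. *)
Definition on_curve (k : nat) (Q : C -> C) (t z y : C) : Prop :=
  Q z <> 0 /\ y ^ k = (z - t) / Q z.

(* Coefficient of dz in eta_t at the point (z, y) of X_t.  On X_t one has
   y = (z - t)^(1/k) Q(z)^(-1/k), so the form
   (z - t)^(1/k - 1) Q(z)^(-1/k) dz is y / (z - t) dz.  [eta_branch] says that
   choosing a point of X_t over z is the same as choosing a value w of the
   multivalued function (z - t)^(1/k - 1) Q(z)^(-1/k). *)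
Definition eta (t z y : C) : C := y / (z - t).

Lemma eta_branch (k : nat) (Q : C -> C) (t z w : C) :
  (1 <= k)%nat -> z <> t -> Q z <> 0 ->
  w ^ k = / ((z - t) ^ (k - 1) * Q z) <->
  exists y : C, on_curve k Q t z y /\ w = eta t z y.
Proof.
  intros hk hz hQ.
  assert (hzt : z - t <> 0).
  { intro h. apply hz. apply Ceq_minus. exact h. }
  assert (hp : (z - t) ^ (k - 1) <> 0) by (apply Cpow_nz; exact hzt).
  assert (hkk : (z - t) ^ k = (z - t) * (z - t) ^ (k - 1)).
  { replace k with (S (k - 1)) at 1 by lia. reflexivity. }
  unfold on_curve, eta; split.
  - intros hw. exists ((z - t) * w). split; [split; [exact hQ|]|].
    + rewrite Cpow_mult_l, hw, hkk. field. auto.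
    + field. exact hzt.
  - intros [y [[_ hy] ->]]. unfold Cdiv.
    rewrite Cpow_mult_l, Cpow_inv, hy, hkk by exact hzt. field. auto.
Qed.

Definition C1_path (h : R -> C) : Prop :=
  exists dh : R -> C,
    forall s : R,
      is_derive (K := R_AbsRing) (V := C_R_NormedModule) h s (dh s) /\
      continuous (T := R_UniformSpace) (U := C_UniformSpace) dh s.

(* On each closed piece g coincides with (the restriction of) a C^1 path; the
   pieces share their end points, so g is continuous on [0,1]. *)
Definition piecewise_C1 (g : R -> C) : Prop :=
  exists (n : nat) (sigma : nat -> R),
    sigma 0%nat = 0%R /\ sigma n = 1%R /\
    forall i : nat, (i < n)%nat ->
      (sigma i < sigma (S i))%R /\
      exists h : R -> C, C1_path h /\
        forall s : R, (sigma i <= s <= sigma (S i))%R -> g s = h s.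

(* Unspecified at the finitely many break points of a piecewise C^1 path, which
   does not affect integrals. *)
Definition velocity (g : R -> C) (s : R) : C :=
  (Derive (fun u => Re (g u)) s, Derive (fun u => Im (g u)) s).

(* A loop [0,1] -> X_t for each t: the path s |-> z(s) in the z-plane does not
   depend on t; [lift t s] is the coordinate y over z(s) on X_t. *)
Record loop : Type := Loop { path : R -> C; lift : C -> R -> C }.

Definition locally_constant_loop (k : nat) (Q : C -> C) (U : C -> Prop)
    (g : loop) : Prop :=
  piecewise_C1 (path g) /\
  path g 0 = path g 1 /\
  (forall (t : C) (s : R), U t -> (0 <= s <= 1)%R ->
     path g s <> t /\ on_curve k Q t (path g s) (lift g t s)) /\
  (forall t : C, U t -> lift g t 0 = lift g t 1) /\
  (forall (t : C) (s : R), U t -> (0 <= s <= 1)%R ->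
     filterlim (fun p : C * R => lift g (fst p) (snd p))
       (within (fun p : C * R => U (fst p) /\ (0 <= snd p <= 1)%R)
          (locally (T := prod_UniformSpace C_UniformSpace R_UniformSpace)
             (t, s)))
       (locally (T := C_UniformSpace) (lift g t s))).

(* A 1-cycle: a formal integral combination of loops. *)
Definition cycle : Type := list (Z * loop).

Definition locally_constant_cycle (k : nat) (Q : C -> C) (U : C -> Prop)
    (gamma : cycle) : Prop :=
  forall (m : Z) (g : loop), In (m, g) gamma -> locally_constant_loop k Q U g.

Definition loop_integral (g : loop) (t : C) : C :=
  RInt (V := C_R_CompleteNormedModule)
    (fun s => eta t (path g s) (lift g t s) * velocity (path g) s) 0 1.

Definition cycle_integral (gamma : cycle) (t : C) : C :=
  fold_right (fun p acc => RtoC (IZR (fst p)) * loop_integral (snd p) t + acc)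
    (RtoC 0) gamma.

(* Like [C_derive], total: meaningful where the successive derivatives exist,
   i.e. under [C_ex_derive_n]. *)
Fixpoint C_derive_n (f : C -> C) (n : nat) (t : C) : C :=
  match n with
  | O => f t
  | S m => C_derive (C_derive_n f m) t
  end.

Definition C_ex_derive_n (f : C -> C) (n : nat) (t : C) : Prop :=
  match n with
  | O => True
  | S m => ex_derive (K := C_AbsRing) (V := C_NormedModule) (C_derive_n f m) t
  end.

Fixpoint pochhammer (x : R) (m : nat) : R :=
  match m with
  | O => 1%R
  | S p => (pochhammer x p * (x + INR p))%R
  end.

Definition alpha (k : nat) : R := ((INR k - 1) / INR k)%R.

Definition Lop (k : nat) (Q f : C -> C) (t : C) : C :=
  sum_n (G := C_AbelianMonoid)
    (fun j =>
       RtoC (INR (k + 1 - j) / (INR (fact j) * pochhammer (alpha k) (k - j)))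
       * C_derive_n Q j t * C_derive_n f (k - j) t) k.

(* Main.v *)
(* Put $w_n = (z-t)^{1/k-1-n}Q(z)^{-1/k} = y/(z-t)^{n+1}$, so that $\partial_t w_n = (\alpha+n)\,w_{n+1}$
    and $I_\gamma^{(n)} = (\alpha)_n\int_\gamma w_n\,dz$.  With $q_j = Q^{(j)}(t)/j!$, the equation reads
    $\sum_{j\le k}(k+1-j)\,q_j\int_\gamma w_{k-j}\,dz = 0$, and the integrand is exact: expanding $Q$ at $t$,
    $$d\Big(\frac{y\,Q(z)}{(z-t)^k}\Big) = -\alpha\sum_{j\le k}(k+1-j)\,q_j\,w_{k-j}\,dz.$$
    Only continuity of the branch $y$ is given.  Its differentiability in $t$ and along the path comes from
    Caratheodory's form of the derivative, an increment divided by the increment of the variable being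
    continuous: the increment of $y$ is that of $y^k$ divided by
    $\sum_i y(u)^i y(x)^{k-1-i}$, which does not vanish at $u = x$.  Here the quotient is jointly
    continuous in $t$ and the path parameter, which also gives differentiation under the integral. *)

Require Import Defs.
From Stdlib Require Import Reals.
From Coquelicot Require Import Coquelicot.
From Stdlib Require Import Arith Lra Lia Classical ClassicalEpsilon.

Local Open Scope C_scope.

(** * Complex-valued continuous functions and finite sums *)

(** The target carries the metric of [Cmod], for which [C] is an absolute-value ring and products
    and inverses are easy to estimate; [C_UniformSpace] uses the product structure of the plane
    instead. *)
Definition ccontinuous {T : UniformSpace} (f : T -> C) (x : T) : Prop :=
  continuous (U := AbsRing_UniformSpace C_AbsRing) f x.

Lemma ccontinuousP {T : UniformSpace} (f : T -> C) (x : T) :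
  ccontinuous f x <->
  forall eps : posreal, locally x (fun u => (Cmod (f u - f x) < eps)%R).
Proof. exact (filterlim_locally (U := AbsRing_UniformSpace C_AbsRing) f (f x)). Qed.

(** The modulus metric and the product structure have the same neighbourhoods, so results pass
    freely between the two. *)
Lemma ccontinuous_C {T : UniformSpace} (f : T -> C) (x : T) :
  ccontinuous f x <-> continuous (U := C_UniformSpace) f x.
Proof.
split; intros h P hP; apply h; apply locally_C; exact hP.
Qed.

Lemma ccontinuous_const {T : UniformSpace} (c : C) (x : T) :
  ccontinuous (fun _ => c) x.
Proof. apply continuous_const. Qed.

Lemma ccontinuous_comp {S T : UniformSpace} (g : S -> T) (f : T -> C) (x : S) :
  continuous g x -> ccontinuous f (g x) -> ccontinuous (fun u => f (g u)) x.
Proof. apply continuous_comp. Qed.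

Lemma ccontinuous_plus {T : UniformSpace} (f g : T -> C) (x : T) :
  ccontinuous f x -> ccontinuous g x -> ccontinuous (fun u => f u + g u) x.
Proof.
exact (continuous_plus (V := AbsRing_NormedModule C_AbsRing) f g x).
Qed.

Lemma ccontinuous_mult {T : UniformSpace} (f g : T -> C) (x : T) :
  ccontinuous f x -> ccontinuous g x -> ccontinuous (fun u => f u * g u) x.
Proof. exact (continuous_mult (K := C_AbsRing) f g x). Qed.

Lemma ccontinuous_opp {T : UniformSpace} (f : T -> C) (x : T) :
  ccontinuous f x -> ccontinuous (fun u => - f u) x.
Proof.
exact (continuous_opp (V := AbsRing_NormedModule C_AbsRing) f x).
Qed.

Lemma ccontinuous_minus {T : UniformSpace} (f g : T -> C) (x : T) :
  ccontinuous f x -> ccontinuous g x -> ccontinuous (fun u => f u - g u) x.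
Proof. intros hf hg. apply ccontinuous_plus; [|apply ccontinuous_opp]; auto. Qed.

Lemma ccontinuous_pow {T : UniformSpace} (f : T -> C) (x : T) (n : nat) :
  ccontinuous f x -> ccontinuous (fun u => f u ^ n) x.
Proof.
intros hf; induction n as [|n IH]; simpl.
- apply ccontinuous_const.
- apply ccontinuous_mult; auto.
Qed.

Lemma ccontinuous_ext_loc {T : UniformSpace} (f g : T -> C) (x : T) :
  locally x (fun u => f u = g u) -> ccontinuous f x -> ccontinuous g x.
Proof.
intros h hf. apply (continuous_ext_loc (U := AbsRing_UniformSpace C_AbsRing) g f x).
- exact h.
- exact hf.
Qed.

Lemma locally_neq0 {T : UniformSpace} (f : T -> C) (x : T) :
  ccontinuous f x -> f x <> 0 -> locally x (fun u => f u <> 0).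
Proof.
intros hf hx. assert (hpos := proj1 (Cmod_gt_0 _) hx).
generalize (proj1 (ccontinuousP f x) hf (mkposreal _ hpos)).
apply filter_imp; simpl; intros u hu h0. rewrite h0 in hu.
replace (0 - f x) with (- f x) in hu by ring.
rewrite Cmod_opp in hu. lra.
Qed.

Lemma ccontinuous_inv {T : UniformSpace} (f : T -> C) (x : T) :
  ccontinuous f x -> f x <> 0 -> ccontinuous (fun u => / f u) x.
Proof.
intros hf hx. assert (hpos := proj1 (Cmod_gt_0 _) hx). set (m := Cmod (f x)) in *.
apply ccontinuousP. intros eps.
assert (hm2 : (0 < m / 2)%R) by lra.
(* Here $|1/f(u)-1/f(x)| = |f(u)-f(x)|/(|f(u)|\,m)$, and $|f(u)|>m/2$ near $x$; this radius makes
   the quotient smaller than [eps]. *)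
assert (hd : (0 < eps * (m / 2) * m)%R).
{ apply Rmult_lt_0_compat; [apply Rmult_lt_0_compat; [apply cond_pos|]|]; lra. }
generalize (filter_and _ _ (proj1 (ccontinuousP f x) hf (mkposreal _ hm2))
  (filter_and _ _ (proj1 (ccontinuousP f x) hf (mkposreal _ hd)) (locally_neq0 f x hf hx))).
apply filter_imp; simpl; intros u (h1 & h2 & h3).
replace (/ f u - / f x) with (- (f u - f x) / (f u * f x)) by (field; auto).
assert (hl : (m / 2 < Cmod (f u))%R).
{ assert (h := Cmod_triangle (f u) (- (f u - f x))). rewrite Cmod_opp in h.
  replace (f u + - (f u - f x)) with (f x) in h by ring. fold m in h. lra. }
rewrite Cmod_div by (apply Cmult_neq_0; auto).
rewrite Cmod_opp, Cmod_mult. fold m.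
apply Rmult_lt_reg_r with (Cmod (f u) * m)%R; [apply Rmult_lt_0_compat; lra|].
unfold Rdiv. rewrite Rmult_assoc, Rinv_l by (apply Rmult_integral_contrapositive; split; lra).
rewrite Rmult_1_r. eapply Rlt_trans; [exact h2|].
rewrite Rmult_assoc. apply Rmult_lt_compat_l; [apply cond_pos|].
apply Rmult_lt_compat_r; lra.
Qed.

(* [sum_n] at the type [C] itself, as [ring] and [field] need. *)
Definition csum (f : nat -> C) (n : nat) : C := sum_n (G := C_AbelianMonoid) f n.

Lemma csum_S (f : nat -> C) (n : nat) :
  csum f (S n) = csum f n + f (S n).
Proof. exact (sum_Sn (G := C_AbelianMonoid) f n). Qed.

Lemma csum_O (f : nat -> C) : csum f 0 = f O.
Proof. exact (sum_O (G := C_AbelianMonoid) f). Qed.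

Lemma csum_plus (f g : nat -> C) (n : nat) :
  csum (fun i => f i + g i) n =
  csum f n + csum g n.
Proof. exact (sum_n_plus (G := C_AbelianMonoid) f g n). Qed.

Lemma csum_mult (c : C) (f : nat -> C) (n : nat) :
  csum (fun i => c * f i) n =
  c * csum f n.
Proof. exact (sum_n_mult_l (K := C_Ring) c f n). Qed.

Lemma csum_ext (f g : nat -> C) (n : nat) :
  (forall i, (i <= n)%nat -> f i = g i) ->
  csum f n = csum g n.
Proof. exact (sum_n_ext_loc (G := C_AbelianMonoid) f g n). Qed.

Lemma csum_shift (u : nat -> C) (n : nat) :
  u O = 0 ->
  csum u (S n) = csum (fun i => u (S i)) n.
Proof.
intros h0. induction n as [|n IH].
- rewrite csum_S, !csum_O, h0. ring.
- rewrite csum_S, IH, csum_S. reflexivity.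
Qed.

Lemma ccontinuous_sum {T : UniformSpace} (f : nat -> T -> C) (x : T) (n : nat) :
  (forall i, (i <= n)%nat -> ccontinuous (f i) x) ->
  ccontinuous (fun u => csum (fun i => f i u) n) x.
Proof.
intros hf; induction n as [|n IH].
- apply (ccontinuous_ext_loc (f O)); [|auto].
  apply filter_forall; intros u. now rewrite csum_O.
- apply (ccontinuous_ext_loc
    (fun u => csum (fun i => f i u) n + f (S n) u)).
  + apply filter_forall; intros u. now rewrite csum_S.
  + apply ccontinuous_plus; auto.
Qed.

Lemma Cinv_neq0 (x : C) : x <> 0 -> / x <> 0.
Proof.
intros hx h. apply R1_neq_R0, RtoC_inj.
transitivity (x * / x); [field; auto|rewrite h; ring].
Qed.

(** * Slopes *)

(* Derivatives in the sense of Caratheodory, both of functions of one variable x ([rho] constant,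
   [iota u = u - x]) and of one variable with a parameter ([rho] resets the variable to its base
   value, [iota] is the increment of the variable). *)
Definition has_slope {T : UniformSpace} (rho : T -> T) (iota : T -> C) (x : T)
    (f : T -> C) (l : C) : Prop :=
  ccontinuous f x /\
  exists phi : T -> C, ccontinuous phi x /\ phi x = l /\
    locally x (fun u => f u - f (rho u) = phi u * iota u).

(** What the reset map must satisfy for [f (rho u)] to tend to [f x]; the product, inverse and root
    rules all evaluate functions at [rho u]. *)
Definition retracts_to {T : UniformSpace} (rho : T -> T) (x : T) : Prop :=
  rho x = x /\ continuous rho x.

Lemma retracts_to_comp {T : UniformSpace} (rho : T -> T) (x : T) (f : T -> C) :
  retracts_to rho x -> ccontinuous f x -> ccontinuous (fun u => f (rho u)) x.
Proof.
intros [h1 h2] hf. apply ccontinuous_comp; [exact h2|]. rewrite h1; exact hf.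
Qed.

Lemma retracts_to_locally {T : UniformSpace} (rho : T -> T) (x : T) (P : T -> Prop) :
  retracts_to rho x -> locally x P -> locally x (fun u => P (rho u)).
Proof.
intros [h1 h2] hP. apply (h2 P). rewrite h1; exact hP.
Qed.

Lemma retracts_to_const {T : UniformSpace} (x : T) : retracts_to (fun _ => x) x.
Proof. split; [reflexivity|apply continuous_const]. Qed.

Lemma has_slope_eq {T : UniformSpace} (rho : T -> T) (iota : T -> C) (x : T)
    (f : T -> C) (l l' : C) :
  has_slope rho iota x f l -> l = l' -> has_slope rho iota x f l'.
Proof. now intros h <-. Qed.

Lemma has_slope_ext {T : UniformSpace} (rho : T -> T) (iota : T -> C) (x : T)
    (f g : T -> C) (l : C) :
  (forall u, f u = g u) -> has_slope rho iota x f l -> has_slope rho iota x g l.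
Proof.
intros h [hf (p & hp & e & ep)]. split.
- apply (ccontinuous_ext_loc f); [now apply filter_forall|exact hf].
- exists p; repeat split; auto. revert ep; apply filter_imp; intros u. now rewrite !h.
Qed.

Lemma has_slope_linear {T : UniformSpace} (rho : T -> T) (iota : T -> C) (x : T)
    (f : T -> C) (c : C) :
  ccontinuous f x -> (forall u, f u - f (rho u) = c * iota u) ->
  has_slope rho iota x f c.
Proof.
intros hf h; split; [exact hf|]. exists (fun _ => c).
split; [apply ccontinuous_const|split; [reflexivity|]].
now apply filter_forall.
Qed.

Lemma has_slope_const {T : UniformSpace} (rho : T -> T) (iota : T -> C) (x : T)
    (f : T -> C) :
  ccontinuous f x -> (forall u, f (rho u) = f u) -> has_slope rho iota x f 0.
Proof. intros hf h. apply has_slope_linear; [exact hf|]. intros u. rewrite h. ring. Qed.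

Lemma has_slope_plus {T : UniformSpace} (rho : T -> T) (iota : T -> C) (x : T)
    (f g : T -> C) (l m : C) :
  has_slope rho iota x f l -> has_slope rho iota x g m ->
  has_slope rho iota x (fun u => f u + g u) (l + m).
Proof.
intros [hf (p & hp & <- & ep)] [hg (q & hq & <- & eq)].
split; [apply ccontinuous_plus; auto|].
exists (fun u => p u + q u).
split; [apply ccontinuous_plus; auto|split; [reflexivity|]].
generalize (filter_and _ _ ep eq). apply filter_imp. intros u [h1 h2].
transitivity ((f u - f (rho u)) + (g u - g (rho u))); [ring|].
rewrite h1, h2. ring.
Qed.

Lemma has_slope_mult {T : UniformSpace} (rho : T -> T) (iota : T -> C) (x : T)
    (f g : T -> C) (l m : C) :
  retracts_to rho x ->
  has_slope rho iota x f l -> has_slope rho iota x g m ->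
  has_slope rho iota x (fun u => f u * g u) (l * g x + f x * m).
Proof.
intros hr [hf (p & hp & <- & ep)] [hg (q & hq & <- & eq)].
split; [apply ccontinuous_mult; auto|].
(* From $fg - f_\rho g_\rho = (f-f_\rho)g + f_\rho(g-g_\rho)$, where the index marks composition
   with [rho]. *)
exists (fun u => p u * g u + f (rho u) * q u).
split; [|split; [now rewrite (proj1 hr)|]].
- apply ccontinuous_plus; apply ccontinuous_mult; auto.
  now apply retracts_to_comp.
- generalize (filter_and _ _ ep eq). apply filter_imp. intros u [h1 h2].
  transitivity ((f u - f (rho u)) * g u + f (rho u) * (g u - g (rho u))); [ring|].
  rewrite h1, h2. ring.
Qed.

Lemma has_slope_scal {T : UniformSpace} (rho : T -> T) (iota : T -> C) (x : T)
    (f : T -> C) (c l : C) :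
  has_slope rho iota x f l -> has_slope rho iota x (fun u => c * f u) (c * l).
Proof.
intros [hf (p & hp & <- & ep)].
split; [apply ccontinuous_mult; auto using ccontinuous_const|].
exists (fun u => c * p u).
split; [apply ccontinuous_mult; auto using ccontinuous_const|split; [reflexivity|]].
revert ep. apply filter_imp. intros u h1.
transitivity (c * (f u - f (rho u))); [ring|]. rewrite h1. ring.
Qed.

Lemma has_slope_inv {T : UniformSpace} (rho : T -> T) (iota : T -> C) (x : T)
    (f : T -> C) (l : C) :
  retracts_to rho x -> f x <> 0 ->
  has_slope rho iota x f l ->
  has_slope rho iota x (fun u => / f u) (- l * (/ f x) ^ 2).
Proof.
intros hr hx [hf (p & hp & <- & ep)].
split; [apply ccontinuous_inv; auto|].
assert (hfr := retracts_to_comp rho x f hr hf).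
exists (fun u => - p u * (/ f u * / f (rho u))).
split; [|split; [rewrite (proj1 hr); now simpl; ring|]].
- apply ccontinuous_mult; [apply ccontinuous_opp; auto|].
  apply ccontinuous_mult; apply ccontinuous_inv; auto.
  now rewrite (proj1 hr).
- assert (hn := locally_neq0 f x hf hx).
  generalize (filter_and _ _ ep (filter_and _ _ hn (retracts_to_locally _ _ _ hr hn))).
  apply filter_imp. intros u (h1 & h2 & h3).
  transitivity (- (f u - f (rho u)) * (/ f u * / f (rho u))); [field; auto|].
  rewrite h1. ring.
Qed.

Lemma has_slope_pow {T : UniformSpace} (rho : T -> T) (iota : T -> C) (x : T)
    (f : T -> C) (l : C) (n : nat) :
  retracts_to rho x ->
  has_slope rho iota x f l ->
  has_slope rho iota x (fun u => f u ^ n) (RtoC (INR n) * f x ^ (n - 1) * l).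
Proof.
intros hr hf. induction n as [|n IH].
- simpl. eapply has_slope_eq; [apply has_slope_const|ring].
  + apply ccontinuous_const.
  + reflexivity.
- eapply has_slope_eq; [exact (has_slope_mult rho iota x f _ _ _ hr hf IH)|].
  replace (S n - 1)%nat with n by lia. rewrite S_INR, RtoC_plus.
  destruct n as [|n]; [simpl; ring|].
  replace (S n - 1)%nat with n by lia. simpl. ring.
Qed.

Lemma has_slope_sum {T : UniformSpace} (rho : T -> T) (iota : T -> C) (x : T)
    (f : nat -> T -> C) (l : nat -> C) (n : nat) :
  (forall i, (i <= n)%nat -> has_slope rho iota x (f i) (l i)) ->
  has_slope rho iota x (fun u => csum (fun i => f i u) n)
    (csum l n).
Proof.
intros h. induction n as [|n IH].
- rewrite csum_O. destruct (h O (le_n _)) as [hf (p & hp & e & ep)]. split.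
  + apply ccontinuous_sum; intros i hi. replace i with O by lia. exact hf.
  + exists p; repeat split; auto. revert ep; apply filter_imp; intros u.
    now rewrite !csum_O.
- rewrite csum_S.
  destruct (has_slope_plus rho iota x _ _ _ _ (IH (fun i hi => h i (le_S _ _ hi)))
    (h (S n) (le_n _))) as [hf (p & hp & e & ep)]. split.
  + apply ccontinuous_sum; intros i hi. exact (proj1 (h i hi)).
  + exists p; repeat split; auto. revert ep; apply filter_imp; intros u.
    now rewrite !csum_S.
Qed.

(** The polynomial $\sum_{i<n} v^i w^{n-1-i}$, that is $(v^n-w^n)/(v-w)$ without the division; it
    remains meaningful at $v=w$. *)
Fixpoint sum_pow (v w : C) (n : nat) : C :=
  match n with
  | O => 0
  | S m => v * sum_pow v w m + w ^ m
  end.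

Lemma sum_pow_diff (v w : C) (n : nat) :
  v ^ n - w ^ n = (v - w) * sum_pow v w n.
Proof.
induction n as [|n IH]; simpl; [ring|].
transitivity (v * (v ^ n - w ^ n) + (v - w) * w ^ n); [ring|]. rewrite IH. ring.
Qed.

Lemma sum_pow_diag (v : C) (n : nat) :
  sum_pow v v n = RtoC (INR n) * v ^ (n - 1).
Proof.
induction n as [|n IH]; [simpl; ring|].
simpl sum_pow. rewrite IH, S_INR, RtoC_plus. replace (S n - 1)%nat with n by lia.
destruct n as [|n]; [simpl; ring|].
replace (S n - 1)%nat with n by lia. simpl. ring.
Qed.

Lemma ccontinuous_sum_pow {T : UniformSpace} (f g : T -> C) (x : T) (n : nat) :
  ccontinuous f x -> ccontinuous g x -> ccontinuous (fun u => sum_pow (f u) (g u) n) x.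
Proof.
intros hf hg; induction n as [|n IH]; simpl.
- apply ccontinuous_const.
- apply ccontinuous_plus; [apply ccontinuous_mult; auto|apply ccontinuous_pow; auto].
Qed.

Lemma INR_neq0_C (n : nat) : (1 <= n)%nat -> RtoC (INR n) <> 0.
Proof. intros hn h. apply (not_0_INR n); [lia|]. now apply RtoC_inj. Qed.

(** The increment of [y] is that of [f] divided by [sum_pow (y u) (y (rho u)) n], which tends to
    $n\,y(x)^{n-1}\ne0$. No branch of the root is constructed: a continuous one is given. *)
Lemma has_slope_root {T : UniformSpace} (rho : T -> T) (iota : T -> C) (x : T)
    (y f : T -> C) (l : C) (n : nat) :
  retracts_to rho x -> (1 <= n)%nat -> ccontinuous y x -> y x <> 0 ->
  locally x (fun u => y u ^ n = f u) ->
  has_slope rho iota x f l ->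
  has_slope rho iota x y (l / (RtoC (INR n) * y x ^ (n - 1))).
Proof.
intros hr hn hy hx he [hf (p & hp & <- & ep)].
split; [exact hy|].
assert (hyr := retracts_to_comp rho x y hr hy).
assert (hs := ccontinuous_sum_pow y (fun u => y (rho u)) x n hy hyr).
assert (h0 : sum_pow (y x) (y (rho x)) n <> 0).
{ rewrite (proj1 hr), sum_pow_diag. apply Cmult_neq_0.
  - now apply INR_neq0_C.
  - now apply Cpow_nz. }
exists (fun u => p u * / sum_pow (y u) (y (rho u)) n).
split; [|split].
- apply ccontinuous_mult; auto. now apply ccontinuous_inv.
- rewrite (proj1 hr), sum_pow_diag. reflexivity.
- generalize (filter_and _ _ (filter_and _ _ ep (locally_neq0 _ x hs h0))
    (filter_and _ _ he (retracts_to_locally _ _ _ hr he))).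
  apply filter_imp. intros u ((h1 & h2) & h3 & h4). cbv beta in *.
  assert (h5 := sum_pow_diff (y u) (y (rho u)) n). rewrite h3, h4, h1 in h5.
  transitivity (((y u - y (rho u)) * sum_pow (y u) (y (rho u)) n)
    * / sum_pow (y u) (y (rho u)) n); [field; auto|].
  rewrite <- h5. ring.
Qed.

(** * Slopes along the real line and in the complex plane *)

Definition real_slope (f : R -> C) (s : R) (l : C) : Prop :=
  has_slope (T := R_UniformSpace) (fun _ => s) (fun u => RtoC (u - s)) s f l.

Definition complex_slope (f : C -> C) (z l : C) : Prop :=
  has_slope (T := AbsRing_UniformSpace C_AbsRing) (fun _ => z) (fun u => u - z) z f l.

Lemma complex_slope_is_derive (f : C -> C) (z l : C) :
  complex_slope f z l -> is_derive (K := C_AbsRing) (V := C_NormedModule) f z l.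
Proof.
intros [hf (p & hp & hl & ep)]. split; [apply is_linear_scal_l|].
(* Differentiability along a filter is quantified over the limits of that filter; the neighbourhood
   filter of [z] has only the limit [z]. *)
intros x hx. apply (is_filter_lim_locally_unique (V := AbsRing_NormedModule C_AbsRing) z x) in hx. subst x.
intros eps. generalize (filter_and _ _ ep (proj1 (ccontinuousP p z) hp eps)).
apply filter_imp. intros u [h1 h2].
change (Cmod (f u - f z - (u - z) * l) <= eps * Cmod (u - z))%R.
rewrite h1. replace (p u * (u - z) - (u - z) * l) with ((p u - l) * (u - z)) by ring.
rewrite Cmod_mult. apply Rmult_le_compat_r; [apply Cmod_ge_0|].
rewrite <- hl. now apply Rlt_le.
Qed.

Lemma is_derive_real_slope (f : R -> C) (s : R) (l : C) :
  is_derive (K := R_AbsRing) (V := C_R_NormedModule) f s l -> real_slope f s l.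
Proof.
intros h. split.
{ apply ccontinuous_C. apply (ex_derive_continuous (V := C_R_NormedModule)).
  now exists l. }
destruct h as [_ h]. specialize (h s (fun P hP => hP)).
(* The difference quotient, completed by the derivative at [u = s]. *)
exists (fun u => if Req_dec_T u s then l else (f u - f s) / RtoC (u - s)).
assert (hs : (if Req_dec_T s s then l else (f s - f s) / RtoC (s - s)) = l).
{ destruct (Req_dec_T s s) as [_|n]; [reflexivity|now destruct n]. }
split; [|split; [exact hs|]].
- apply ccontinuousP. rewrite hs. intros eps.
  (* Differentiability yields a non-strict bound while continuity asks for a strict one, hence the
     half. *)
  assert (he : (0 < eps / 2)%R) by (destruct eps; simpl; lra).
  generalize (h (mkposreal _ he)). apply filter_imp. intros u hu.
  destruct (Req_dec_T u s) as [_|n].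
  + replace (l - l) with (RtoC 0) by ring. rewrite Cmod_0. apply cond_pos.
  + assert (hus : (u - s <> 0)%R) by lra.
    assert (huC : RtoC (u - s) <> 0) by (intros e; apply hus; now apply RtoC_inj).
    change (norm (V := C_R_NormedModule)
       (minus (minus (f u) (f s)) (scal (minus u s) l)) <= eps / 2 * Rabs (u - s))%R in hu.
    rewrite <- Cmod_norm in hu.
    replace ((f u - f s) / RtoC (u - s) - l)
      with ((f u - f s - RtoC (u - s) * l) / RtoC (u - s)) by (field; auto).
    rewrite Cmod_div, Cmod_R by auto.
    assert (hp : (0 < Rabs (u - s))%R) by now apply Rabs_pos_lt.
    apply Rle_lt_trans with (eps / 2)%R; [|destruct eps; simpl; lra].
    apply Rmult_le_reg_r with (Rabs (u - s)); [exact hp|].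
    unfold Rdiv at 1. rewrite Rmult_assoc, Rinv_l, Rmult_1_r by lra.
    replace (f u - f s - RtoC (u - s) * l) with
      (minus (minus (f u) (f s)) (scal (minus u s) l) : C_R_NormedModule); [exact hu|].
    rewrite <- scal_R_Cmult. reflexivity.
- apply filter_forall; intros u. destruct (Req_dec_T u s) as [->|n].
  + replace (s - s)%R with 0%R by ring. ring.
  + assert (huC : RtoC (u - s) <> 0).
    { intros e. apply RtoC_inj in e. lra. }
    field. exact huC.
Qed.

(** Common part of the two component statements that follow: [pr] is [Re] or [Im], both bounded by
    [Cmod], so the complex error term controls the real one. *)
Lemma is_derive_of_increment (f : R -> R) (s : R) (phi : R -> C) (l : R)
    (pr : C -> R) :
  (forall z : C, (Rabs (pr z) <= Cmod z)%R) ->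
  ccontinuous (T := R_UniformSpace) phi s ->
  locally (T := R_UniformSpace) s (fun u =>
    (f u - f s - (u - s) * l)%R = pr ((phi u - phi s) * RtoC (u - s))) ->
  is_derive f s l.
Proof.
intros hpr hphi hf. split; [apply is_linear_scal_l|].
intros x hx. apply (is_filter_lim_locally_unique (V := AbsRing_NormedModule R_AbsRing) s x) in hx. subst x.
intros eps. generalize (filter_and _ _ hf (proj1 (ccontinuousP phi s) hphi eps)).
apply filter_imp. intros u [h1 h2].
change (Rabs (f u - f s - (u - s) * l) <= eps * Rabs (u - s))%R.
rewrite h1. eapply Rle_trans; [apply hpr|].
rewrite Cmod_mult, Cmod_R. apply Rmult_le_compat_r; [apply Rabs_pos|].
now apply Rlt_le.
Qed.

Lemma im_le_Cmod (z : C) : (Rabs (Im z) <= Cmod z)%R.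
Proof. eapply Rle_trans; [apply Rmax_r|apply Rmax_Cmod]. Qed.

Lemma real_slope_Re (f : R -> C) (s : R) (l : C) :
  real_slope f s l -> is_derive (fun u => Re (f u)) s (Re l).
Proof.
intros [hf (p & hp & hl & ep)].
apply (is_derive_of_increment _ _ p _ Re re_le_Cmod hp).
revert ep. apply filter_imp. intros u hu. rewrite hl.
replace ((p u - l) * RtoC (u - s)) with (f u - f s - RtoC (u - s) * l)
  by (rewrite hu; ring).
destruct (f u), (f s), l. simpl. ring.
Qed.

Lemma real_slope_Im (f : R -> C) (s : R) (l : C) :
  real_slope f s l -> is_derive (fun u => Im (f u)) s (Im l).
Proof.
intros [hf (p & hp & hl & ep)].
apply (is_derive_of_increment _ _ p _ Im im_le_Cmod hp).
revert ep. apply filter_imp. intros u hu. rewrite hl.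
replace ((p u - l) * RtoC (u - s)) with (f u - f s - RtoC (u - s) * l)
  by (rewrite hu; ring).
destruct (f u), (f s), l. simpl. ring.
Qed.

(** Gives the total, componentwise [velocity] its expected value wherever the path really is
    differentiable. *)
Lemma real_slope_velocity (f : R -> C) (s : R) (l : C) :
  real_slope f s l -> velocity f s = l.
Proof.
intros h. apply injective_projections.
- exact (is_derive_unique _ _ _ (real_slope_Re f s l h)).
- exact (is_derive_unique _ _ _ (real_slope_Im f s l h)).
Qed.

(** * The fundamental theorem of calculus for complex-valued functions *)

Lemma ccontinuous_Re (f : R -> C) (s : R) :
  ccontinuous (T := R_UniformSpace) f s -> continuity_pt (fun u => Re (f u)) s.
Proof.
intros h. apply continuity_pt_filterlim. apply (proj2 (filterlim_locally _ _)). intros eps.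
generalize (proj1 (ccontinuousP f s) h eps). apply filter_imp. intros u hu.
change (Rabs (Re (f u) - Re (f s)) < eps)%R.
eapply Rle_lt_trans; [|exact hu].
replace (Re (f u) - Re (f s))%R with (Re (f u - f s)) by reflexivity.
apply re_le_Cmod.
Qed.

Lemma ccontinuous_Im (f : R -> C) (s : R) :
  ccontinuous (T := R_UniformSpace) f s -> continuity_pt (fun u => Im (f u)) s.
Proof.
intros h. apply continuity_pt_filterlim. apply (proj2 (filterlim_locally _ _)). intros eps.
generalize (proj1 (ccontinuousP f s) h eps). apply filter_imp. intros u hu.
change (Rabs (Im (f u) - Im (f s)) < eps)%R.
eapply Rle_lt_trans; [|exact hu].
replace (Im (f u) - Im (f s))%R with (Im (f u - f s)) by reflexivity.
apply im_le_Cmod.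
Qed.

(** The mean value theorem fails for complex values, so it is applied to the real and imaginary
    parts separately. *)
Lemma real_slope_zero_const (f : R -> C) (a b : R) :
  (a < b)%R ->
  (forall s, ccontinuous (T := R_UniformSpace) f s) ->
  (forall s, (a < s < b)%R -> real_slope f s 0) -> f b = f a.
Proof.
intros hab hc hd.
assert (hm : Rmin a b = a) by (apply Rmin_left; lra).
assert (hM : Rmax a b = b) by (apply Rmax_right; lra).
destruct (MVT_gen (fun u => Re (f u)) a b (fun _ => 0%R)) as [c1 [_ e1]].
- rewrite hm, hM. intros s hs. exact (real_slope_Re f s 0 (hd s hs)).
- intros s _. now apply ccontinuous_Re.
- destruct (MVT_gen (fun u => Im (f u)) a b (fun _ => 0%R)) as [c2 [_ e2]].
  + rewrite hm, hM. intros s hs. exact (real_slope_Im f s 0 (hd s hs)).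
  + intros s _. now apply ccontinuous_Im.
  + apply injective_projections; [change (Re (f b) = Re (f a))|change (Im (f b) = Im (f a))]; lra.
Qed.

Lemma ccontinuous_ex_RInt (f : R -> C) (a b : R) :
  (forall s, ccontinuous (T := R_UniformSpace) f s) ->
  ex_RInt (V := C_R_CompleteNormedModule) f a b.
Proof.
intros h. apply (ex_RInt_continuous (V := C_R_CompleteNormedModule)). intros s _.
apply ccontinuous_C. apply h.
Qed.

(** [F] minus the indefinite integral of [f] has slope zero inside the interval, hence equal end
    values. The slope of [F] is asked for only in the open interval, since the clamped paths used
    below may have corners at the end points. *)
Lemma RInt_open_FTC (F f : R -> C) (a b : R) :
  (a < b)%R ->
  (forall s, ccontinuous (T := R_UniformSpace) F s) ->
  (forall s, ccontinuous (T := R_UniformSpace) f s) ->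
  (forall s, (a < s < b)%R -> real_slope F s (f s)) ->
  RInt (V := C_R_CompleteNormedModule) f a b = F b - F a.
Proof.
intros hab hF hf hd.
set (I := (fun x : R => RInt (V := C_R_CompleteNormedModule) f a x) : R -> C).
assert (hI : forall s, real_slope I s (f s)).
{ intros s. apply is_derive_real_slope.
  apply (is_derive_RInt (V := C_R_NormedModule) f I a s).
  - apply filter_forall. intros x.
    apply (RInt_correct (V := C_R_CompleteNormedModule)). now apply ccontinuous_ex_RInt.
  - apply ccontinuous_C. apply hf. }
assert (e := real_slope_zero_const (fun x => F x + (-1) * I x) a b hab).
cbv beta in e.
assert (e0 : I a = RtoC 0) by exact (RInt_point (V := C_R_CompleteNormedModule) a f).
rewrite e0 in e.
change (I b = F b - F a).
assert (e1 : F b + -1 * I b = F a + -1 * 0).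
{ apply e.
  - intros s. apply ccontinuous_plus; [apply hF|].
    apply ccontinuous_mult; [apply ccontinuous_const|exact (proj1 (hI s))].
  - intros s hs. eapply has_slope_eq.
    + apply has_slope_plus; [exact (hd s hs)|].
      apply has_slope_scal. exact (hI s).
    + ring. }
transitivity (F b - (F b + -1 * I b)); [ring|]. rewrite e1. ring.
Qed.

(** * Integrals depending on a complex parameter *)

Lemma is_RInt_Cplus (f g : R -> C) (a b : R) (l m : C) :
  is_RInt (V := C_R_NormedModule) f a b l -> is_RInt (V := C_R_NormedModule) g a b m ->
  is_RInt (V := C_R_NormedModule) (fun s => f s + g s) a b (l + m).
Proof. exact (is_RInt_plus (V := C_R_NormedModule) f g a b l m). Qed.

(** Integration takes place in a real vector space; a complex factor mixes the two components, so
    each component is integrated as a real combination of both. *)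
Lemma is_RInt_Cmult (c : C) (f : R -> C) (a b : R) (l : C) :
  is_RInt (V := C_R_NormedModule) f a b l ->
  is_RInt (V := C_R_NormedModule) (fun s => c * f s) a b (c * l).
Proof.
intros h.
assert (h1 : is_RInt (fun s => fst (f s)) a b (fst l))
  by exact (is_RInt_fct_extend_fst (U := R_NormedModule) (V := R_NormedModule) f a b l h).
assert (h2 : is_RInt (fun s => snd (f s)) a b (snd l))
  by exact (is_RInt_fct_extend_snd (U := R_NormedModule) (V := R_NormedModule) f a b l h).
apply (is_RInt_fct_extend_pair (U := R_NormedModule) (V := R_NormedModule)
  (fun s => c * f s) a b).
- apply (is_RInt_minus (V := R_NormedModule)); apply (is_RInt_scal (V := R_NormedModule)); auto.
- apply (is_RInt_plus (V := R_NormedModule)); apply (is_RInt_scal (V := R_NormedModule)); auto.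
Qed.

(** The derivative in the parameter at [t0], with a slope function jointly continuous at [(t0, s)]
    and an identity valid also for nearby values of [s]. This joint form is what compactness turns
    into uniformity. *)
Definition param_slope (f : C -> R -> C) (t0 : C) (s : R) (l : C) : Prop :=
  has_slope (T := prod_UniformSpace C_UniformSpace R_UniformSpace)
    (fun p => (t0, snd p)) (fun p => fst p - t0) (t0, s)
    (fun p => f (fst p) (snd p)) l.

Lemma ccontinuous_fst (p : C * R) :
  ccontinuous (T := prod_UniformSpace C_UniformSpace R_UniformSpace) fst p.
Proof.
apply ccontinuous_C. intros P [eps h]. exists eps. intros q [h1 _]. now apply h.
Qed.

Lemma continuous_snd (p : C * R) :
  continuous (T := prod_UniformSpace C_UniformSpace R_UniformSpace)
    (U := R_UniformSpace) snd p.
Proof. intros P [eps h]. exists eps. intros q [_ h1]. now apply h. Qed.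

Lemma retracts_to_snd (t0 : C) (s : R) :
  retracts_to (T := prod_UniformSpace C_UniformSpace R_UniformSpace)
    (fun p => (t0, snd p)) (t0, s).
Proof.
split; [reflexivity|]. intros P [eps h]. exists eps. intros q [_ h1]. apply h.
split; [apply ball_center|exact h1].
Qed.

Lemma tube_lemma (P : C -> R -> Prop) (t0 : C) (a b : R) :
  (forall s, (a <= s <= b)%R ->
     locally (T := prod_UniformSpace C_UniformSpace R_UniformSpace) (t0, s)
       (fun p => P (fst p) (snd p))) ->
  locally (T := C_UniformSpace) t0 (fun t => forall s, (a <= s <= b)%R -> P t s).
Proof.
intros h.
(* A radius is chosen for every real [s]; outside the interval its value is arbitrary, here 1. *)
assert (hex : forall s : R, {d : posreal | (a <= s <= b)%R ->
  forall p : C * R, ball (M := prod_UniformSpace C_UniformSpace R_UniformSpace) (t0, s) d p ->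
    P (fst p) (snd p)}).
{ intros s. apply constructive_indefinite_description. destruct (classic (a <= s <= b)%R) as [hs|hs].
  - destruct (h s hs) as [d hd]. now exists d.
  - exists (mkposreal 1 Rlt_0_1). tauto. }
set (delta := fun s => proj1_sig (hex s)).
(* Compactness yields one [d] such that each [s] lies within [delta x] of some [x] of the interval
   with [d <= delta x]. The existence of [x] comes doubly negated, hence the argument by
   contradiction. *)
destruct (compactness_value_1d a b delta) as [d hd].
exists d. intros t ht s hs. apply NNPP. intros hn. apply (hd s hs).
intros [x (hx & hsx & hdx)]. apply hn.
apply (proj2_sig (hex x) hx (t, s)). split.
- apply (ball_le _ d); [exact hdx|exact ht].
- exact hsx.
Qed.

(** Differentiation under the integral sign: the first-order error is small uniformly in [s] by
    [tube_lemma], and then it is integrated. *)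
Lemma is_derive_RInt_param_slope (f : C -> R -> C) (l : R -> C) (a b : R) (t0 : C) :
  (a <= b)%R ->
  (forall s, param_slope f t0 s (l s)) ->
  (forall s, ccontinuous (T := R_UniformSpace) l s) ->
  locally (T := C_UniformSpace) t0 (fun t => ex_RInt (V := C_R_NormedModule) (f t) a b) ->
  is_derive (K := C_AbsRing) (V := C_NormedModule)
    (fun t => RInt (V := C_R_CompleteNormedModule) (f t) a b) t0
    (RInt (V := C_R_CompleteNormedModule) l a b).
Proof.
intros hab hf hl hex. split; [apply is_linear_scal_l|].
intros x hx.
apply (is_filter_lim_locally_unique (V := AbsRing_NormedModule C_AbsRing) t0 x) in hx. subst x.
intros eps.
(* The added 1 keeps the denominator positive when [a = b], and
   $(b-a)\,\varepsilon/(b-a+1)\le\varepsilon$. *)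
assert (he : (0 < eps / (b - a + 1))%R)
  by (apply Rdiv_lt_0_compat; [apply cond_pos|lra]).
set (e := mkposreal _ he).
assert (hloc : locally (T := C_UniformSpace) t0 (fun t => forall s, (a <= s <= b)%R ->
  (Cmod (f t s - f t0 s - (t - t0) * l s) <= e * Cmod (t - t0))%R)).
{ apply tube_lemma. intros s _.
  destruct (hf s) as [_ (p & hp & hpl & ep)].
  assert (hls : ccontinuous (T := prod_UniformSpace C_UniformSpace R_UniformSpace)
    (fun q => l (snd q)) (t0, s))
    by (apply (ccontinuous_comp snd l); [apply continuous_snd|apply hl]).
  (* The relative error at a nearby [(t, s')] is [p (t, s') - l s']: continuous, and zero at
     [(t0, s)]. *)
  generalize (filter_and _ _ ep
    (proj1 (ccontinuousP _ _) (ccontinuous_minus _ _ _ hp hls) e)).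
  apply filter_imp; intros [t s'] [h1 h2]; cbn [fst snd] in *.
  rewrite h1. rewrite hpl in h2.
  replace (p (t, s') * (t - t0) - (t - t0) * l s')
    with ((p (t, s') - l s' - (l s - l s)) * (t - t0)) by ring.
  rewrite Cmod_mult. apply Rmult_le_compat_r; [apply Cmod_ge_0|now apply Rlt_le]. }
apply locally_C.
assert (h0 : ex_RInt (V := C_R_NormedModule) (f t0) a b) by exact (locally_singleton _ _ hex).
assert (hlI := ccontinuous_ex_RInt l a b hl).
generalize (filter_and _ _ hloc hex). apply filter_imp. intros t [h1 h2].
change (Cmod (RInt (V := C_R_CompleteNormedModule) (f t) a b
  - RInt (V := C_R_CompleteNormedModule) (f t0) a b
  - (t - t0) * RInt (V := C_R_CompleteNormedModule) l a b) <= eps * Cmod (t - t0))%R.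
assert (r : is_RInt (V := C_R_NormedModule) (fun s => f t s + (-1) * f t0 s + - (t - t0) * l s) a b
  (RInt (V := C_R_CompleteNormedModule) (f t) a b
  + (-1) * RInt (V := C_R_CompleteNormedModule) (f t0) a b
  + - (t - t0) * RInt (V := C_R_CompleteNormedModule) l a b)).
{ apply (is_RInt_Cplus (fun s => f t s + (-1) * f t0 s) (fun s => - (t - t0) * l s)).
  - apply (is_RInt_Cplus (f t) (fun s => (-1) * f t0 s)).
    + now apply (RInt_correct (V := C_R_CompleteNormedModule)).
    + apply is_RInt_Cmult. now apply (RInt_correct (V := C_R_CompleteNormedModule)).
  - apply is_RInt_Cmult. now apply (RInt_correct (V := C_R_CompleteNormedModule)). }
assert (hn := fun hle =>
  norm_RInt_le_const (V := C_R_NormedModule) _ a b _ (e * Cmod (t - t0))%R hab hle r).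
replace (RInt (V := C_R_CompleteNormedModule) (f t) a b
  - RInt (V := C_R_CompleteNormedModule) (f t0) a b
  - (t - t0) * RInt (V := C_R_CompleteNormedModule) l a b)
  with (RInt (V := C_R_CompleteNormedModule) (f t) a b
  + (-1) * RInt (V := C_R_CompleteNormedModule) (f t0) a b
  + - (t - t0) * RInt (V := C_R_CompleteNormedModule) l a b) by ring.
rewrite Cmod_norm. eapply Rle_trans; [apply hn|].
{ intros s hs. rewrite <- Cmod_norm.
  replace (f t s + (-1) * f t0 s + - (t - t0) * l s)
    with (f t s - f t0 s - (t - t0) * l s) by ring. exact (h1 s hs). }
unfold e; simpl.
rewrite <- Rmult_assoc. apply Rmult_le_compat_r; [apply Cmod_ge_0|].
apply Rmult_le_reg_r with (b - a + 1)%R; [lra|].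
replace ((b - a) * (eps / (b - a + 1)) * (b - a + 1))%R with ((b - a) * eps)%R by (field; lra).
assert (h := cond_pos eps). nra.
Qed.

(** * Taylor expansion of Q *)

(** Coefficients of a polynomial in powers of $z-t$. The truncation [N] may be any bound above [n],
    so expansions of different degrees combine without realignment. *)
Definition expansion_at (t : C) (n : nat) (f : C -> C) (q : nat -> C) : Prop :=
  (forall j, (n < j)%nat -> q j = 0) /\
  forall (N : nat) (z : C), (n <= N)%nat ->
    f z = csum (fun j => q j * (z - t) ^ j) N.

Lemma expansion_at_weaken (t : C) (n m : nat) (f : C -> C) (q : nat -> C) :
  (n <= m)%nat -> expansion_at t n f q -> expansion_at t m f q.
Proof.
intros hnm [h1 h2]. split; intros; [apply h1|apply h2]; lia.
Qed.

Lemma expansion_at_plus (t : C) (n : nat) (f g : C -> C) (p q : nat -> C) :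
  expansion_at t n f p -> expansion_at t n g q ->
  expansion_at t n (fun z => f z + g z) (fun j => p j + q j).
Proof.
intros [hp hf] [hq hg]. split.
- intros j hj. rewrite hp, hq by lia. ring.
- intros N z hN. rewrite (hf N z hN), (hg N z hN), <- csum_plus.
  apply csum_ext; intros; ring.
Qed.

Lemma expansion_at_scal (t : C) (n : nat) (c : C) (f : C -> C) (q : nat -> C) :
  expansion_at t n f q ->
  expansion_at t n (fun z => c * f z) (fun j => c * q j).
Proof.
intros [hq hf]. split.
- intros j hj. rewrite hq by lia. ring.
- intros N z hN. rewrite (hf N z hN), <- csum_mult.
  apply csum_ext; intros; ring.
Qed.

(** Write $z=(z-t)+t$: the first summand shifts the coefficients, the second scales them. *)
Lemma expansion_at_Xmul (t : C) (n : nat) (f : C -> C) (q : nat -> C) :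
  expansion_at t n f q ->
  expansion_at t (S n) (fun z => z * f z)
    (fun j => match j with O => 0 | S i => q i end + t * q j).
Proof.
intros [hq hf]. split.
- intros [|j] hj; [lia|]. rewrite !hq by lia. ring.
- intros [|N] z hN; [lia|].
  transitivity ((z - t) * f z + t * f z); [ring|].
  rewrite (hf N z ltac:(lia)) at 1. rewrite (hf (S N) z ltac:(lia)).
  rewrite <- !csum_mult.
  rewrite <- (csum_shift (fun j => match j with O => 0 | S i => (z - t) * (q i * (z - t) ^ i) end))
    by reflexivity.
  rewrite <- csum_plus. apply csum_ext. intros [|i] _; simpl; ring.
Qed.

Lemma expansion_at_one (t : C) :
  expansion_at t 0 (fun _ => 1) (fun j => match j with O => 1 | S _ => 0 end).
Proof.
split.
- intros [|j] hj; [lia|reflexivity].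
- intros N z _. induction N as [|N IH].
  + rewrite csum_O. simpl. ring.
  + rewrite csum_S, <- IH. ring.
Qed.

Lemma expansion_at_pow (t : C) (n : nat) :
  exists q, expansion_at t n (fun z => z ^ n) q.
Proof.
induction n as [|n [q hq]].
- eexists. apply expansion_at_one.
- eexists. exact (expansion_at_Xmul t n _ q hq).
Qed.

(** Existence suffices here; the coefficients are identified with derivatives in
    [monic_poly_taylor]. *)
Lemma expansion_at_monic_poly (k : nat) (a : nat -> C) (t : C) :
  exists q, expansion_at t (k + 1) (monic_poly k a) q.
Proof.
assert (h : exists q, expansion_at t k
  (fun z => csum (fun i => a i * z ^ i) k) q).
{ induction k as [|k [q hq]].
  - destruct (expansion_at_pow t 0) as [p hp].
    destruct (expansion_at_scal t 0 (a O) _ p hp) as [h1 h2].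
    eexists; split; [exact h1|]. intros N z hN. rewrite csum_O. apply (h2 N z hN).
  - destruct (expansion_at_pow t (S k)) as [p hp].
    destruct (expansion_at_plus t (S k) _ _ _ _
      (expansion_at_weaken t k (S k) _ q (le_S _ _ (le_n k)) hq)
      (expansion_at_scal t (S k) (a (S k)) _ p hp)) as [h1 h2].
    eexists; split; [exact h1|]. intros N z hN. rewrite csum_S. apply (h2 N z hN). }
destruct h as [q hq]. destruct (expansion_at_pow t (k + 1)) as [p hp].
eexists. apply (expansion_at_plus t (k + 1) (fun z => z ^ (k + 1))).
- exact hp.
- apply (expansion_at_weaken t k); [lia|exact hq].
Qed.

Lemma complex_slope_sub_pow (t z : C) (j : nat) :
  complex_slope (fun u => (u - t) ^ j) z (RtoC (INR j) * (z - t) ^ (j - 1)).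
Proof.
eapply (has_slope_eq (T := AbsRing_UniformSpace C_AbsRing)).
- apply (has_slope_pow (T := AbsRing_UniformSpace C_AbsRing) _ _ _ (fun u => u - t));
    [apply retracts_to_const|].
  apply (has_slope_linear (T := AbsRing_UniformSpace C_AbsRing) _ _ _ (fun u => u - t) 1).
  + apply (ccontinuous_minus (T := AbsRing_UniformSpace C_AbsRing) (fun u => u) (fun _ => t)).
    * exact (@continuous_id (AbsRing_UniformSpace C_AbsRing) z).
    * apply ccontinuous_const.
  + intros u. ring.
- ring.
Qed.

(** Both sums keep the bound [n]: the term [j = 0] on the left has factor zero, and the term [j = n]
    on the right contains [q (S n) = 0]. *)
Lemma csum_deriv_reindex (q : nat -> C) (w : C) (n : nat) :
  (forall j, (n < j)%nat -> q j = 0) ->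
  csum (fun j => q j * (RtoC (INR j) * w ^ (j - 1))) n =
  csum (fun j => RtoC (INR (S j)) * q (S j) * w ^ j) n.
Proof.
intros hq.
transitivity (csum (fun j => q j * (RtoC (INR j) * w ^ (j - 1))) (S n)).
- rewrite csum_S, (hq (S n)) by lia. ring.
- rewrite csum_shift by (simpl; ring). apply csum_ext. intros i _.
  replace (S i - 1)%nat with i by lia. ring.
Qed.

(** Differentiating termwise $m$ times gives $p_j=\frac{(j+m)!}{j!}q_{j+m}$, recorded without
    division. The bound [n] is not lowered with [m]; the missing top coefficients are zero. *)
Lemma C_derive_n_expansion_at (t : C) (n : nat) (f : C -> C) (q : nat -> C) (m : nat) :
  expansion_at t n f q ->
  exists p, (forall j, RtoC (INR (fact j)) * p j = RtoC (INR (fact (j + m))) * q (j + m)%nat) /\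
    (forall j, (n < j)%nat -> p j = 0) /\
    forall z, C_derive_n f m z = csum (fun j => p j * (z - t) ^ j) n.
Proof.
intros [hq hf]. induction m as [|m (p & h1 & h2 & h3)].
- exists q. repeat split; auto.
  intros j. now rewrite Nat.add_0_r.
- exists (fun j => RtoC (INR (S j)) * p (S j)). split; [|split].
  + intros j. replace (j + S m)%nat with (S j + m)%nat by lia. rewrite <- h1.
    change (fact (S j)) with (S j * fact j)%nat. rewrite mult_INR, RtoC_mult. ring.
  + intros j hj. rewrite h2 by lia. ring.
  + intros z. change (C_derive (C_derive_n f m) z =
      csum (fun j => RtoC (INR (S j)) * p (S j) * (z - t) ^ j) n).
    rewrite <- csum_deriv_reindex by exact h2.
    apply is_C_derive_unique.
    apply (is_derive_ext (V := C_NormedModule)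
      (fun z => csum (fun j => p j * (z - t) ^ j) n)).
    { intros u. symmetry. apply h3. }
    apply complex_slope_is_derive.
    apply (has_slope_sum (T := AbsRing_UniformSpace C_AbsRing) _ _ _ (fun j u => p j * (u - t) ^ j)).
    intros i _. apply (has_slope_scal (T := AbsRing_UniformSpace C_AbsRing)).
    apply complex_slope_sub_pow.
Qed.

Lemma csum_pow_zero (q : nat -> C) (n : nat) (w : C) :
  w = 0 -> csum (fun j => q j * w ^ j) n = q O.
Proof.
intros ->. induction n as [|n IH].
- rewrite csum_O. simpl. ring.
- rewrite csum_S, IH. simpl. ring.
Qed.

Lemma INR_fact_neq0_C (n : nat) : RtoC (INR (fact n)) <> 0.
Proof. apply INR_neq0_C. assert (h := lt_O_fact n). lia. Qed.

Definition taylor_coeff (f : C -> C) (t : C) (j : nat) : C :=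
  C_derive_n f j t / RtoC (INR (fact j)).

Lemma monic_poly_taylor (k : nat) (a : nat -> C) (t z : C) :
  monic_poly k a z =
  csum
    (fun j => taylor_coeff (monic_poly k a) t j * (z - t) ^ j) (k + 1).
Proof.
destruct (expansion_at_monic_poly k a t) as [q hq].
rewrite (proj2 hq (k + 1)%nat z (le_n _)). apply csum_ext. intros j _. f_equal.
unfold taylor_coeff.
destruct (C_derive_n_expansion_at t (k + 1) _ q j hq) as (p & h1 & _ & h3).
rewrite h3, csum_pow_zero by ring.
(* The value at [t] of the [j]-th derivative is its constant coefficient, $j!\,q_j$. *)
specialize (h1 O). simpl Nat.add in h1.
replace (p O) with (RtoC (INR (fact 0)) * p O) by (simpl; ring).
rewrite h1. field. apply INR_fact_neq0_C.
Qed.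

(** * Arcs on the curve *)

Lemma ccontinuous_monic_poly {T : UniformSpace} (k : nat) (a : nat -> C)
    (f : T -> C) (x : T) :
  ccontinuous f x -> ccontinuous (fun u => monic_poly k a (f u)) x.
Proof.
intros hf.
apply (ccontinuous_plus (fun u => f u ^ (k + 1)) (fun u => csum (fun i => a i * f u ^ i) k)).
- now apply ccontinuous_pow.
- apply (ccontinuous_sum (fun i u => a i * f u ^ i)). intros i _.
  apply ccontinuous_mult; [apply ccontinuous_const|now apply ccontinuous_pow].
Qed.

(** One smooth piece of a loop with its lift, extended to all of [R] so that continuity is two-sided
    everywhere. Only in the open interval must [dz] be the speed. *)
Record arc (k : nat) (Q : C -> C) (U : C -> Prop) (lo hi : R)
    (z dz : R -> C) (Y : C -> R -> C) : Prop := {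
  arc_cont : forall s, ccontinuous (T := R_UniformSpace) z s;
  arc_speed_cont : forall s, ccontinuous (T := R_UniformSpace) dz s;
  arc_speed : forall s, (lo < s < hi)%R -> real_slope z s (dz s);
  arc_lift_cont : forall t s, U t ->
    ccontinuous (T := prod_UniformSpace C_UniformSpace R_UniformSpace)
      (fun p => Y (fst p) (snd p)) (t, s);
  arc_avoids : forall t s, U t -> z s <> t;
  arc_on_curve : forall t s, U t -> on_curve k Q t (z s) (Y t s) }.

(* n-th t-derivative of the integrand, without its factor [pochhammer (alpha k) n]. *)
Definition arc_form (z dz : R -> C) (Y : C -> R -> C) (n : nat) (t : C) (s : R) : C :=
  Y t s * (/ (z s - t)) ^ S n * dz s.

(* The primitive (z - t)^(1/k - k) Q(z)^(1 - 1/k), written as a function on the curve. *)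
Definition arc_primitive (k : nat) (Q : C -> C) (z : R -> C) (Y : C -> R -> C)
    (t : C) (s : R) : C :=
  Y t s * Q (z s) * (/ (z s - t)) ^ k.

Lemma Cminus_neq0 (x y : C) : x <> y -> x - y <> 0.
Proof. intros h e. apply h. now apply Ceq_minus. Qed.

Lemma root_neq0 (k : nat) (y w : C) : (1 <= k)%nat -> y ^ k = w -> w <> 0 -> y <> 0.
Proof.
intros hk <- hw ->. apply hw. destruct k as [|k]; [lia|]. simpl. ring.
Qed.

(** Logarithmic form of the derivative of a root: $y^{k-1}$ is eliminated through $y^k=r/q$, so
    later identities are linear in $y$ and accessible to [field]. *)
Lemma root_slope_simpl (k : nat) (y r q l : C) :
  (1 <= k)%nat -> r <> 0 -> q <> 0 -> y ^ k = r / q ->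
  l / (RtoC (INR k) * y ^ (k - 1)) = y * l * q * / r / RtoC (INR k).
Proof.
intros hk hr hq e.
assert (hy : y <> 0).
{ apply (root_neq0 k y _ hk e). apply Cmult_neq_0; [exact hr|].
  now apply Cinv_neq0. }
assert (hyk : y ^ (k - 1) <> 0) by now apply Cpow_nz.
assert (hkk := INR_neq0_C k hk).
replace k with (S (k - 1)) in e at 1 by lia. simpl in e.
replace r with (y * y ^ (k - 1) * q) by (rewrite e; field; auto).
field. auto.
Qed.

Lemma alpha_C (k : nat) : (1 <= k)%nat -> RtoC (alpha k) = 1 - / RtoC (INR k).
Proof.
intros hk. unfold alpha. assert (h : (INR k <> 0)%R) by (apply not_0_INR; lia).
rewrite RtoC_div by exact h. rewrite RtoC_minus. field. now apply INR_neq0_C.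
Qed.

Lemma open_locally_fst (U : C -> Prop) (t : C) (s : R) :
  open (T := C_UniformSpace) U -> U t ->
  locally (T := prod_UniformSpace C_UniformSpace R_UniformSpace) (t, s) (fun p => U (fst p)).
Proof.
intros hU ht. destruct (hU t ht) as [eps h]. exists eps. intros q [h1 _]. now apply h.
Qed.

Lemma ccontinuous_slice (f : C -> R -> C) (t : C) (s : R) :
  ccontinuous (T := prod_UniformSpace C_UniformSpace R_UniformSpace)
    (fun p => f (fst p) (snd p)) (t, s) ->
  ccontinuous (T := R_UniformSpace) (f t) s.
Proof.
intros h P hP. destruct (h P hP) as [eps he]. exists eps. intros u hu.
apply (he (t, u)). split; [apply ball_center|exact hu].
Qed.

Lemma ccontinuous_arc_form k Q U lo hi z dz Y (n : nat) (t : C) (s : R) :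
  arc k Q U lo hi z dz Y -> U t -> ccontinuous (T := R_UniformSpace) (arc_form z dz Y n t) s.
Proof.
intros A ht. apply ccontinuous_mult; [|apply (arc_speed_cont _ _ _ _ _ _ _ _ A)].
apply ccontinuous_mult.
- apply ccontinuous_slice. now apply (arc_lift_cont _ _ _ _ _ _ _ _ A).
- apply (ccontinuous_pow (fun s => / (z s - t))). apply ccontinuous_inv.
  + apply ccontinuous_minus; [apply (arc_cont _ _ _ _ _ _ _ _ A)|apply ccontinuous_const].
  + apply Cminus_neq0. now apply (arc_avoids _ _ _ _ _ _ _ _ A).
Qed.

(** Since $\partial_t y=-\frac1k\,y/(z-t)$, the branch contributes $-1/k$ and the power
    $(z-t)^{-(n+1)}$ contributes $n+1$; together they give $\alpha+n$. *)
Lemma param_slope_arc_form k a U lo hi z dz Y (n : nat) (t : C) (s : R) :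
  (1 <= k)%nat -> open (T := C_UniformSpace) U ->
  arc k (monic_poly k a) U lo hi z dz Y -> U t ->
  param_slope (arc_form z dz Y n) t s
    ((RtoC (alpha k) + RtoC (INR n)) * arc_form z dz Y (S n) t s).
Proof.
intros hk hU A ht.
set (T := prod_UniformSpace C_UniformSpace R_UniformSpace).
assert (hr0 : z s - t <> 0) by (apply Cminus_neq0; now apply (arc_avoids _ _ _ _ _ _ _ _ A)).
destruct (arc_on_curve _ _ _ _ _ _ _ _ A t s ht) as [hq hyk].
assert (hret := retracts_to_snd t s).
assert (hsnd : forall f : R -> C, ccontinuous (T := R_UniformSpace) f s ->
  ccontinuous (T := T) (fun p => f (snd p)) (t, s)).
{ intros f hf. apply (ccontinuous_comp (S := T) snd f); [apply continuous_snd|exact hf]. }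
assert (sz : param_slope (fun t s => z s - t) t s (-1)).
{ apply has_slope_linear.
  - apply ccontinuous_minus; [apply hsnd, (arc_cont _ _ _ _ _ _ _ _ A)|apply ccontinuous_fst].
  - intros [t' s']. simpl. ring. }
assert (sq : param_slope (fun _ s => / monic_poly k a (z s)) t s 0).
{ apply has_slope_const; [|reflexivity].
  apply (hsnd (fun s => / monic_poly k a (z s))). apply ccontinuous_inv; [|exact hq].
  apply ccontinuous_monic_poly, (arc_cont _ _ _ _ _ _ _ _ A). }
assert (sdz : param_slope (fun _ s => dz s) t s 0).
{ apply has_slope_const; [|reflexivity].
  apply hsnd, (arc_speed_cont _ _ _ _ _ _ _ _ A). }
assert (sv := has_slope_inv _ _ _ _ _ hret hr0 sz).
assert (hy0 : Y t s <> 0).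
{ apply (root_neq0 k _ _ hk hyk). apply Cmult_neq_0; [exact hr0|].
  now apply Cinv_neq0. }
assert (sY : param_slope Y t s (Y t s * (-1 * / monic_poly k a (z s) + (z s - t) * 0)
  * monic_poly k a (z s) * / (z s - t) / RtoC (INR k))).
{ eapply has_slope_eq; [|exact (root_slope_simpl k _ _ _ _ hk hr0 hq hyk)].
  apply (has_slope_root _ _ (t, s) (fun p => Y (fst p) (snd p))
    (fun p => (z (snd p) - fst p) * / monic_poly k a (z (snd p))));
    [exact hret|exact hk|now apply (arc_lift_cont _ _ _ _ _ _ _ _ A)|exact hy0| |].
  - generalize (open_locally_fst U t s hU ht). apply filter_imp.
    intros p hp. exact (proj2 (arc_on_curve _ _ _ _ _ _ _ _ A (fst p) (snd p) hp)).
  - exact (has_slope_mult _ _ _ _ _ _ _ hret sz sq). }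
eapply has_slope_eq.
- apply has_slope_mult; [exact hret| |exact sdz].
  apply has_slope_mult; [exact hret| |].
  + exact sY.
  + apply has_slope_pow; [exact hret|exact sv].
- cbn [fst snd]. rewrite alpha_C by exact hk. unfold arc_form.
  replace (S n - 1)%nat with n by lia. rewrite S_INR, RtoC_plus.
  assert (hkk := INR_neq0_C k hk). simpl.
  field. repeat split; auto.
Qed.

(** The coefficient $(k+1-j)\,q_j$ left in the operator once $(\alpha)_{k-j}$ has cancelled against
    the same factor of the derivative. *)
Definition lop_weight (k : nat) (Q : C -> C) (t : C) (j : nat) : C :=
  RtoC (INR (k + 1 - j)) * taylor_coeff Q t j.

(* Euler's identity for the expansion of Q at t; the top term j = k + 1 drops out. *)
Lemma csum_lop_weight (k : nat) (a : nat -> C) (t w : C) :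
  csum (fun j => lop_weight k (monic_poly k a) t j * (w - t) ^ j) k =
  RtoC (INR (k + 1)) * monic_poly k a w
  - (w - t) * csum (fun j => taylor_coeff (monic_poly k a) t j
                              * (RtoC (INR j) * (w - t) ^ (j - 1))) (k + 1).
Proof.
rewrite (monic_poly_taylor k a t w). set (q := taylor_coeff (monic_poly k a) t).
transitivity (csum (fun j => lop_weight k (monic_poly k a) t j * (w - t) ^ j) (k + 1)).
- assert (h0 : lop_weight k (monic_poly k a) t (S k) = 0).
  { unfold lop_weight. replace (k + 1 - S k)%nat with 0%nat by lia. simpl. ring. }
  rewrite Nat.add_1_r, csum_S, h0. ring.
- transitivity (RtoC (INR (k + 1)) * csum (fun j => q j * (w - t) ^ j) (k + 1)
    + (- (w - t)) * csum (fun j => q j * (RtoC (INR j) * (w - t) ^ (j - 1))) (k + 1)); [|ring].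
  rewrite <- !csum_mult, <- csum_plus. apply csum_ext. intros j hj.
  unfold lop_weight. fold q. rewrite minus_INR, RtoC_minus by exact hj.
  destruct j as [|j]; [simpl; ring|].
  replace (S j - 1)%nat with j by lia. simpl Cpow. ring.
Qed.

Lemma real_slope_arc_primitive k a U lo hi z dz Y (t : C) (s : R) :
  (1 <= k)%nat -> arc k (monic_poly k a) U lo hi z dz Y -> U t -> (lo < s < hi)%R ->
  real_slope (arc_primitive k (monic_poly k a) z Y t) s
    (csum (fun j => - RtoC (alpha k) * lop_weight k (monic_poly k a) t j
                    * arc_form z dz Y (k - j) t s) k).
Proof.
intros hk A ht hs.
assert (hr0 : z s - t <> 0) by (apply Cminus_neq0; now apply (arc_avoids _ _ _ _ _ _ _ _ A)).
destruct (arc_on_curve _ _ _ _ _ _ _ _ A t s ht) as [hq hyk].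
assert (hret := retracts_to_const (T := R_UniformSpace) s).
set (q := taylor_coeff (monic_poly k a) t).
(* The value of $Q'$ at [z s], expanded in powers of [z s - t]. *)
set (D := csum (fun j => q j * (RtoC (INR j) * (z s - t) ^ (j - 1))) (k + 1)).
assert (sr : real_slope (fun s => z s - t) s (dz s)).
{ eapply has_slope_eq; [apply has_slope_plus|].
  - exact (arc_speed _ _ _ _ _ _ _ _ A s hs).
  - apply has_slope_const; [apply ccontinuous_const|reflexivity].
  - ring. }
assert (sQ : real_slope (fun s => monic_poly k a (z s)) s (dz s * D)).
{ apply (has_slope_ext (T := R_UniformSpace) _ _ _ (fun s => csum (fun j => q j * (z s - t) ^ j) (k + 1))).
  { intros u. symmetry. apply monic_poly_taylor. }
  eapply has_slope_eq.
  - apply (has_slope_sum (T := R_UniformSpace) _ _ _ (fun j s => q j * (z s - t) ^ j)).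
    intros j _. apply has_slope_scal. apply has_slope_pow; [exact hret|exact sr].
  - unfold D. rewrite <- csum_mult. apply csum_ext. intros j _. cbv beta. ring. }
assert (sv := has_slope_inv _ _ _ _ _ hret hr0 sr).
assert (hy0 : Y t s <> 0).
{ apply (root_neq0 k _ _ hk hyk). apply Cmult_neq_0; [exact hr0|].
  now apply Cinv_neq0. }
assert (sY : real_slope (Y t) s
  (Y t s * (dz s * / monic_poly k a (z s)
            + (z s - t) * (- (dz s * D) * (/ monic_poly k a (z s)) ^ 2))
   * monic_poly k a (z s) * / (z s - t) / RtoC (INR k))).
{ eapply has_slope_eq; [|exact (root_slope_simpl k _ _ _ _ hk hr0 hq hyk)].
  apply (has_slope_root (T := R_UniformSpace) _ _ s (Y t)
    (fun s => (z s - t) * / monic_poly k a (z s)));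
    [exact hret|exact hk| |exact hy0| |].
  - apply ccontinuous_slice. now apply (arc_lift_cont _ _ _ _ _ _ _ _ A).
  - apply filter_forall. intros u. exact (proj2 (arc_on_curve _ _ _ _ _ _ _ _ A t u ht)).
  - exact (has_slope_mult _ _ _ _ _ _ _ hret sr (has_slope_inv _ _ _ _ _ hret hq sQ)). }
eapply has_slope_eq.
- apply has_slope_mult; [exact hret| |].
  + apply has_slope_mult; [exact hret|exact sY|exact sQ].
  + apply has_slope_pow; [exact hret|exact sv].
(* Differentiating $(z-t)^{1/k-k}Q^{1-1/k}$ gives
   $y(z-t)^{-k-1}\big((\frac1k-k)Q+\alpha(z-t)Q'\big)$. As $\frac1k-k=-(k+1)\alpha$, the bracket is
   $-\alpha\big((k+1)Q-(z-t)Q'\big)$, to which [csum_lop_weight] applies. *)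
- transitivity (- RtoC (alpha k) * Y t s * dz s * (/ (z s - t)) ^ S k
    * csum (fun j => lop_weight k (monic_poly k a) t j * (z s - t) ^ j) k).
  + rewrite csum_lop_weight. fold q. fold D.
    rewrite alpha_C by exact hk.
    rewrite plus_INR, RtoC_plus. change (INR 1) with 1%R.
    assert (hkk := INR_neq0_C k hk).
    destruct k as [|m]; [lia|]. replace (S m - 1)%nat with m by lia.
    set (kappa := RtoC (INR (S m))) in *. cbv beta. simpl Cpow.
    field. repeat split; auto.
  + rewrite <- csum_mult. apply csum_ext. intros j hj. unfold arc_form.
    (* Splitting the exponent lets $(z-t)^j$ cancel, leaving the power of [arc_form] at index
       [k - j]. *)
    replace (S k) with (S (k - j) + j)%nat by lia.
    rewrite Cpow_add_r.
    rewrite (Cpow_inv _ j) by exact hr0.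
    field. repeat split; auto. now apply Cpow_nz.
Qed.

(** * The equation for arcs, loops and cycles *)

Lemma C_is_derive_scal (c : C) (f : C -> C) (t l : C) :
  is_derive (K := C_AbsRing) (V := C_NormedModule) f t l ->
  is_derive (K := C_AbsRing) (V := C_NormedModule) (fun u => c * f u) t (c * l).
Proof.
intros h.
apply (filterdiff_ext_lin (K := C_AbsRing) (U := AbsRing_NormedModule C_AbsRing)
  (V := C_NormedModule) (fun u => c * f u) (fun y => c * (y * l))).
- exact (filterdiff_scal_r_fct (K := C_AbsRing) (U := AbsRing_NormedModule C_AbsRing)
    (V := C_NormedModule) c f _ Cmult_comm h).
- intros y. change (c * (y * l) = y * (c * l)). ring.
Qed.

(* [J n] stands for f^(n) / (alpha)_n. *)
Definition ladder (k : nat) (Q : C -> C) (U : C -> Prop) (f b : C -> C) : Prop :=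
  exists J : nat -> C -> C,
    (forall t, U t -> f t = J O t) /\
    (forall n t, U t ->
       is_derive (K := C_AbsRing) (V := C_NormedModule) (J n) t
         ((RtoC (alpha k) + RtoC (INR n)) * J (S n) t)) /\
    (forall t, U t ->
       csum (fun j => - RtoC (alpha k) * lop_weight k Q t j * J (k - j)%nat t) k = b t).

Lemma ladder_ext k Q U (f g b c : C -> C) :
  ladder k Q U f b -> (forall t, U t -> g t = f t) -> (forall t, U t -> c t = b t) ->
  ladder k Q U g c.
Proof.
intros (J & h1 & h2 & h3) hf hb. exists J. split; [|split]; auto.
- intros t ht. rewrite hf; auto.
- intros t ht. rewrite hb; auto.
Qed.

Lemma ladder_zero k Q U : ladder k Q U (fun _ => 0) (fun _ => 0).
Proof.
exists (fun _ _ => 0). split; [reflexivity|split].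
- intros n t _. rewrite Cmult_0_r. apply (is_derive_const (V := C_NormedModule)).
- intros t _. transitivity (csum (fun j => 0 * 0) k).
  + apply csum_ext. intros. ring.
  + rewrite csum_mult. ring.
Qed.

(** Additivity in the pair of integral and boundary term is what lets boundary terms telescope along
    a loop and reduces cycles to loops. *)
Lemma ladder_plus k Q U (f g b c : C -> C) :
  ladder k Q U f b -> ladder k Q U g c ->
  ladder k Q U (fun t => f t + g t) (fun t => b t + c t).
Proof.
intros (J & h1 & h2 & h3) (K & e1 & e2 & e3).
exists (fun n t => J n t + K n t). split; [|split].
- intros t ht. rewrite h1, e1; auto.
- intros n t ht. rewrite Cmult_plus_distr_l.
  apply (is_derive_plus (V := C_NormedModule)); auto.
- intros t ht. rewrite <- h3, <- e3, <- csum_plus by exact ht.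
  apply csum_ext. intros. ring.
Qed.

Lemma ladder_scal k Q U (m : C) (f b : C -> C) :
  ladder k Q U f b -> ladder k Q U (fun t => m * f t) (fun t => m * b t).
Proof.
intros (J & h1 & h2 & h3).
exists (fun n t => m * J n t). split; [|split].
- intros t ht. rewrite h1; auto.
- intros n t ht.
  replace ((RtoC (alpha k) + RtoC (INR n)) * (m * J (S n) t))
    with (m * ((RtoC (alpha k) + RtoC (INR n)) * J (S n) t)) by ring.
  apply C_is_derive_scal; auto.
- intros t ht. rewrite <- h3, <- csum_mult by exact ht.
  apply csum_ext. intros. ring.
Qed.

Lemma is_RInt_csum (f : nat -> R -> C) (l : nat -> C) (a b : R) (n : nat) :
  (forall i, is_RInt (V := C_R_NormedModule) (f i) a b (l i)) ->
  is_RInt (V := C_R_NormedModule) (fun s => csum (fun i => f i s) n) a b (csum l n).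
Proof.
intros h. induction n as [|n IH].
- rewrite csum_O. apply (is_RInt_ext (V := C_R_NormedModule) (f O)); [|apply h].
  intros s _. now rewrite csum_O.
- rewrite csum_S.
  apply (is_RInt_ext (V := C_R_NormedModule) (fun s => csum (fun i => f i s) n + f (S n) s)).
  + intros s _. now rewrite csum_S.
  + now apply is_RInt_Cplus.
Qed.

(** The witness [J n] is the integral of [arc_form] of index [n]; the boundary term is the increment
    of the primitive. *)
Lemma ladder_arc k a U lo hi z dz Y :
  (1 <= k)%nat -> open (T := C_UniformSpace) U -> (lo < hi)%R ->
  arc k (monic_poly k a) U lo hi z dz Y ->
  ladder k (monic_poly k a) U
    (fun t => RInt (V := C_R_CompleteNormedModule) (arc_form z dz Y 0 t) lo hi)
    (fun t => arc_primitive k (monic_poly k a) z Y t hi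
              - arc_primitive k (monic_poly k a) z Y t lo).
Proof.
intros hk hU hab A.
assert (hc : forall n t, U t -> forall s,
  ccontinuous (T := R_UniformSpace) (arc_form z dz Y n t) s)
  by (intros; eapply ccontinuous_arc_form; eassumption).
assert (hi' : forall n t, U t -> is_RInt (V := C_R_NormedModule) (arc_form z dz Y n t) lo hi
  (RInt (V := C_R_CompleteNormedModule) (arc_form z dz Y n t) lo hi)).
{ intros n t ht. apply (RInt_correct (V := C_R_CompleteNormedModule)).
  apply ccontinuous_ex_RInt. auto. }
exists (fun n t => RInt (V := C_R_CompleteNormedModule) (arc_form z dz Y n t) lo hi).
split; [reflexivity|split].
- intros n t ht.
  replace ((RtoC (alpha k) + RtoC (INR n)) *
     RInt (V := C_R_CompleteNormedModule) (arc_form z dz Y (S n) t) lo hi)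
    with (RInt (V := C_R_CompleteNormedModule)
      (fun s => (RtoC (alpha k) + RtoC (INR n)) * arc_form z dz Y (S n) t s) lo hi).
  + apply is_derive_RInt_param_slope; [lra| | |].
    * intros s. eapply param_slope_arc_form; eassumption.
    * intros s. apply ccontinuous_mult; [apply ccontinuous_const|auto].
    * generalize (hU t ht). apply filter_imp. intros u hu. eexists. apply hi'; exact hu.
  + apply (is_RInt_unique (V := C_R_CompleteNormedModule)). apply is_RInt_Cmult. auto.
- intros t ht.
  rewrite <- (RInt_open_FTC (arc_primitive k (monic_poly k a) z Y t)
    (fun s => csum (fun j => - RtoC (alpha k) * lop_weight k (monic_poly k a) t j
                    * arc_form z dz Y (k - j) t s) k) lo hi hab).
  + symmetry. apply (is_RInt_unique (V := C_R_CompleteNormedModule)).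
    apply (is_RInt_csum (fun j s => - RtoC (alpha k) * lop_weight k (monic_poly k a) t j
                    * arc_form z dz Y (k - j) t s)).
    intros i. apply is_RInt_Cmult. auto.
  + intros s. apply ccontinuous_mult; [apply ccontinuous_mult|].
    * apply ccontinuous_slice. now apply (arc_lift_cont _ _ _ _ _ _ _ _ A).
    * apply ccontinuous_monic_poly, (arc_cont _ _ _ _ _ _ _ _ A).
    * apply (ccontinuous_pow (fun s => / (z s - t))). apply ccontinuous_inv.
      -- apply ccontinuous_minus; [apply (arc_cont _ _ _ _ _ _ _ _ A)|apply ccontinuous_const].
      -- apply Cminus_neq0. now apply (arc_avoids _ _ _ _ _ _ _ _ A).
  + intros s.
    apply (ccontinuous_sum (fun j s => - RtoC (alpha k) * lop_weight k (monic_poly k a) t j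
                    * arc_form z dz Y (k - j) t s)).
    intros i _. apply ccontinuous_mult; [apply ccontinuous_const|auto].
  + intros s hs. eapply real_slope_arc_primitive; eassumption.
Qed.

(** * Cutting loops into arcs *)

(* Precomposing with [clamp lo hi] turns data on a closed piece into data on all of R,
   so that no one-sided limits are needed at the end points. *)
Definition clamp (lo hi s : R) : R := Rmax lo (Rmin s hi).

Lemma clamp_in (lo hi s : R) : (lo <= hi)%R -> (lo <= clamp lo hi s <= hi)%R.
Proof.
intros h. unfold clamp. split; [apply Rmax_l|].
apply Rmax_lub; [exact h|apply Rmin_r].
Qed.

Lemma clamp_id (lo hi s : R) : (lo <= s <= hi)%R -> clamp lo hi s = s.
Proof.
intros h. unfold clamp. rewrite Rmin_left by lra. apply Rmax_right. lra.
Qed.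

Lemma continuous_clamp (lo hi s : R) :
  continuous (T := R_UniformSpace) (U := R_UniformSpace) (clamp lo hi) s.
Proof.
apply (proj2 (filterlim_locally (U := R_UniformSpace) _ _)). intros eps. exists eps. intros u hu.
change (Rabs (u - s) < eps)%R in hu. change (Rabs (clamp lo hi u - clamp lo hi s) < eps)%R.
eapply Rle_lt_trans; [|exact hu]. unfold clamp, Rmax, Rmin.
repeat destruct (Rle_dec _ _); unfold Rabs; repeat destruct (Rcase_abs _); lra.
Qed.

Lemma locally_Ioo (lo hi s : R) (P : R -> Prop) :
  (lo < s < hi)%R -> (forall u, (lo <= u <= hi)%R -> P u) ->
  locally (T := R_UniformSpace) s P.
Proof.
intros hs h. assert (he : (0 < Rmin (s - lo) (hi - s))%R) by (apply Rmin_pos; lra).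
exists (mkposreal _ he). intros u hu. apply h.
change (Rabs (u - s) < Rmin (s - lo) (hi - s))%R in hu.
apply Rabs_def2 in hu.
assert (h1 := Rmin_l (s - lo) (hi - s)). assert (h2 := Rmin_r (s - lo) (hi - s)). lra.
Qed.

(** The lift is continuous only relative to [U] times the unit interval. Clamping maps a full
    neighbourhood into that set, since [U] is open, and so gives unrestricted joint continuity. *)
Lemma arc_of_loop k Q U g (lo hi : R) (h dh : R -> C) :
  open (T := C_UniformSpace) U -> locally_constant_loop k Q U g ->
  (0 <= lo)%R -> (lo < hi)%R -> (hi <= 1)%R ->
  (forall s, is_derive (K := R_AbsRing) (V := C_R_NormedModule) h s (dh s) /\
     continuous (T := R_UniformSpace) (U := C_UniformSpace) dh s) ->
  (forall s, (lo <= s <= hi)%R -> path g s = h s) ->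
  arc k Q U lo hi (fun s => h (clamp lo hi s)) (fun s => dh (clamp lo hi s))
    (fun t s => lift g t (clamp lo hi s)).
Proof.
intros hU (_ & _ & hon & _ & hcont) h0 hlt h1 hder hpath.
assert (hin : forall s, (lo <= clamp lo hi s <= hi)%R) by (intros; apply clamp_in; lra).
split.
- intros s. apply (ccontinuous_comp (clamp lo hi) h); [apply continuous_clamp|].
  apply ccontinuous_C. apply (ex_derive_continuous (V := C_R_NormedModule)).
  eexists. apply hder.
- intros s. apply (ccontinuous_comp (clamp lo hi) dh); [apply continuous_clamp|].
  apply ccontinuous_C. apply hder.
- intros s hs. apply is_derive_real_slope.
  rewrite (clamp_id lo hi s) by lra.
  apply (is_derive_ext_loc (V := C_R_NormedModule) h); [|apply hder].
  apply (locally_Ioo lo hi); [exact hs|]. intros u hu. now rewrite clamp_id.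
- intros t s ht. apply ccontinuous_C.
  apply (filterlim_comp _ _ _ (fun p : C * R => (fst p, clamp lo hi (snd p)))
    (fun p => lift g (fst p) (snd p)) _
    (within (fun p : C * R => U (fst p) /\ (0 <= snd p <= 1)%R)
      (locally (T := prod_UniformSpace C_UniformSpace R_UniformSpace) (t, clamp lo hi s)))).
  + intros P [eps hP].
    destruct (proj1 (filterlim_locally _ _) (continuous_clamp lo hi s) eps) as [d1 hd1].
    assert (hloc := open_locally_fst U t s hU ht).
    assert (hball : locally (T := prod_UniformSpace C_UniformSpace R_UniformSpace) (t, s)
      (fun p => ball (M := C_UniformSpace) t eps (fst p)
                /\ ball (M := R_UniformSpace) (clamp lo hi s) eps (clamp lo hi (snd p)))).
    { exists (mkposreal _ (Rmin_pos _ _ (cond_pos eps) (cond_pos d1))).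
      intros q [q1 q2]. simpl in q1, q2. split.
      - apply (ball_le _ (Rmin eps d1)); [apply Rmin_l|exact q1].
      - apply hd1. apply (ball_le _ (Rmin eps d1)); [apply Rmin_r|exact q2]. }
    unfold filtermap. generalize (filter_and _ _ hloc hball). apply filter_imp.
    intros p (p1 & p2 & p3). apply (hP (fst p, clamp lo hi (snd p))).
    * now split.
    * split; [exact p1|]. change (0 <= clamp lo hi (snd p) <= 1)%R.
      destruct (hin (snd p)). split; eapply Rle_trans; eassumption.
  + apply (hcont t (clamp lo hi s)); [exact ht|].
    destruct (hin s). split; eapply Rle_trans; eassumption.
- intros t s ht. rewrite <- hpath by auto. specialize (hin s). apply hon; [exact ht|lra].
- intros t s ht. rewrite <- hpath by auto. specialize (hin s). apply hon; [exact ht|lra].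
Qed.

Lemma ladder_loop_piece k a U g (lo hi : R) :
  (1 <= k)%nat -> open (T := C_UniformSpace) U ->
  locally_constant_loop k (monic_poly k a) U g ->
  (0 <= lo)%R -> (lo < hi)%R -> (hi <= 1)%R ->
  (exists h : R -> C, C1_path h /\ forall s, (lo <= s <= hi)%R -> path g s = h s) ->
  exists f : C -> C,
    (forall t, U t -> is_RInt (V := C_R_NormedModule)
      (fun s => eta t (path g s) (lift g t s) * velocity (path g) s) lo hi (f t)) /\
    ladder k (monic_poly k a) U f
      (fun t => arc_primitive k (monic_poly k a) (path g) (lift g) t hi
                - arc_primitive k (monic_poly k a) (path g) (lift g) t lo).
Proof.
intros hk hU hg h0 hlt h1 (h & (dh & hder) & hpath).
assert (A := arc_of_loop _ _ _ _ lo hi h dh hU hg h0 hlt h1 hder hpath).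
eexists. split; [|eapply ladder_ext; [exact (ladder_arc _ _ _ _ _ _ _ _ hk hU hlt A)|reflexivity|]].
- intros t ht.
  apply (is_RInt_ext (V := C_R_NormedModule)
    (arc_form (fun s => h (clamp lo hi s)) (fun s => dh (clamp lo hi s))
      (fun t s => lift g t (clamp lo hi s)) 0 t)).
  (* Agreement of the integrands is needed only inside the piece, where the clamp is the identity
     and [velocity] is the derivative of [h]. *)
  + rewrite Rmin_left, Rmax_right by lra. intros s hs. unfold arc_form, eta. cbv beta.
    rewrite (clamp_id lo hi s) by lra. rewrite <- (hpath s) by lra.
    rewrite (real_slope_velocity (path g) s (dh s)).
    * simpl. unfold Cdiv. ring.
    * apply is_derive_real_slope.
      apply (is_derive_ext_loc (V := C_R_NormedModule) h); [|apply hder].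
      apply (locally_Ioo lo hi); [exact hs|]. intros u hu. symmetry. auto.
  + apply (RInt_correct (V := C_R_CompleteNormedModule)). apply ccontinuous_ex_RInt.
    intros s. eapply ccontinuous_arc_form; eassumption.
- intros t ht. unfold arc_primitive. rewrite !clamp_id by lra.
  now rewrite !hpath by lra.
Qed.

Lemma ladder_loop k a U g :
  (1 <= k)%nat -> open (T := C_UniformSpace) U ->
  locally_constant_loop k (monic_poly k a) U g ->
  ladder k (monic_poly k a) U (loop_integral g) (fun _ => 0).
Proof.
intros hk hU hg.
assert (hg' := hg). destruct hg' as ((n & sigma & hs0 & hs1 & hpc) & hclosed & _ & hlift & _).
assert (hmono : forall i j, (i <= j)%nat -> (j <= n)%nat -> (sigma i <= sigma j)%R).
{ intros i j hij. induction hij as [|j hij IH]; intros hj; [lra|].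
  destruct (hpc j hj) as [hlt _]. specialize (IH ltac:(lia)). lra. }
set (G := arc_primitive k (monic_poly k a) (path g) (lift g)).
(* Induction on the number of pieces; the boundary terms at the inner break points cancel. *)
assert (hm : forall m, (m <= n)%nat -> exists f : C -> C,
  (forall t, U t -> is_RInt (V := C_R_NormedModule)
    (fun s => eta t (path g s) (lift g t s) * velocity (path g) s) 0 (sigma m) (f t)) /\
  ladder k (monic_poly k a) U f (fun t => G t (sigma m) - G t 0%R)).
{ induction m as [|m IH]; intros hmn.
  - rewrite hs0. exists (fun _ => 0). split.
    + intros t _. apply (is_RInt_point (V := C_R_NormedModule)).
    + eapply ladder_ext; [apply ladder_zero|reflexivity|]. intros t _. cbv beta. ring.
  - destruct (IH ltac:(lia)) as (f & hf1 & hf2).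
    destruct (hpc m hmn) as [hlt hpath].
    destruct (ladder_loop_piece k a U g (sigma m) (sigma (S m)) hk hU hg) as (f' & hf1' & hf2').
    + rewrite <- hs0. apply hmono; lia.
    + exact hlt.
    + rewrite <- hs1. apply hmono; lia.
    + exact hpath.
    + exists (fun t => f t + f' t). split.
      * intros t ht. apply (is_RInt_Chasles (V := C_R_NormedModule) _ 0 (sigma m)); auto.
      * eapply ladder_ext; [exact (ladder_plus _ _ _ _ _ _ _ hf2 hf2')|reflexivity|].
        intros t _. cbv beta. unfold G. ring. }
destruct (hm n (le_n _)) as (f & hf1 & hf2). rewrite hs1 in hf1, hf2.
eapply ladder_ext; [exact hf2| |].
- intros t ht. apply (is_RInt_unique (V := C_R_CompleteNormedModule)). auto.
(* The path and the lift both close up, so the primitive takes the same value at the two ends. *)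
- intros t ht. unfold G, arc_primitive. rewrite <- hclosed, <- hlift by exact ht. ring.
Qed.

Lemma ladder_cycle k a U gamma :
  (1 <= k)%nat -> open (T := C_UniformSpace) U ->
  locally_constant_cycle k (monic_poly k a) U gamma ->
  ladder k (monic_poly k a) U (cycle_integral gamma) (fun _ => 0).
Proof.
intros hk hU hg. induction gamma as [|[m g] gamma IH].
- apply ladder_zero.
- eapply ladder_ext.
  + apply ladder_plus; [apply (ladder_scal _ _ _ (RtoC (IZR m)))|apply IH].
    * apply (ladder_loop k a U g hk hU). apply (hg m g). now left.
    * intros m' g' h. apply (hg m' g'). now right.
  + reflexivity.
  + intros t _. cbv beta. ring.
Qed.

(** * From the ladder to iterated derivatives and the operator *)

Lemma pochhammer_pos (x : R) (n : nat) : (0 < x)%R -> (0 < pochhammer x n)%R.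
Proof.
intros hx. induction n as [|n IH]; simpl; [lra|].
apply Rmult_lt_0_compat; [exact IH|]. assert (h := pos_INR n). lra.
Qed.

(** For $k=1$ this constant would be 0; positivity permits division by $\alpha$ and by the
    Pochhammer symbols. *)
Lemma alpha_pos (k : nat) : (2 <= k)%nat -> (0 < alpha k)%R.
Proof.
intros hk. assert (h : (2 <= INR k)%R) by exact (le_INR 2 k hk).
apply Rdiv_lt_0_compat; lra.
Qed.

(** Value and derivative are proved together, for all points of [U]: a formula on the whole open set
    can be differentiated again, and existence of the derivative gives the total [C_derive] its
    meaning. *)
Lemma C_derive_n_ladder k (U : C -> Prop) (f : C -> C) (J : nat -> C -> C) (n : nat) :
  open (T := C_UniformSpace) U ->
  (forall t, U t -> f t = J O t) ->
  (forall n t, U t ->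
     is_derive (K := C_AbsRing) (V := C_NormedModule) (J n) t
       ((RtoC (alpha k) + RtoC (INR n)) * J (S n) t)) ->
  forall t, U t ->
    C_derive_n f n t = RtoC (pochhammer (alpha k) n) * J n t /\
    is_derive (K := C_AbsRing) (V := C_NormedModule) (C_derive_n f n) t
      (RtoC (pochhammer (alpha k) (S n)) * J (S n) t).
Proof.
intros hU h0 hd.
assert (key : forall n, (forall t, U t -> C_derive_n f n t = RtoC (pochhammer (alpha k) n) * J n t) ->
  forall t, U t -> is_derive (K := C_AbsRing) (V := C_NormedModule) (C_derive_n f n) t
      (RtoC (pochhammer (alpha k) (S n)) * J (S n) t)).
{ intros m hm t ht.
  apply (is_derive_ext_loc (V := C_NormedModule) (fun u => RtoC (pochhammer (alpha k) m) * J m u)).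
  - apply locally_C. generalize (hU t ht). apply filter_imp. intros u hu. symmetry. auto.
  - replace (RtoC (pochhammer (alpha k) (S m)) * J (S m) t)
      with (RtoC (pochhammer (alpha k) m) * ((RtoC (alpha k) + RtoC (INR m)) * J (S m) t)).
    + apply C_is_derive_scal. auto.
    + cbn [pochhammer]. rewrite RtoC_mult, RtoC_plus. ring. }
induction n as [|n IH]; intros t ht.
- assert (e : forall t, U t -> C_derive_n f 0 t = RtoC (pochhammer (alpha k) 0) * J O t).
  { intros u hu. simpl. rewrite h0 by exact hu. ring. }
  split; [auto|]. now apply key.
- assert (e : forall t, U t -> C_derive_n f (S n) t = RtoC (pochhammer (alpha k) (S n)) * J (S n) t).
  { intros u hu. exact (is_C_derive_unique _ _ _ (proj2 (IH u hu))). }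
  split; [auto|]. now apply key.
Qed.

Theorem proposition3 (k : nat) (hk : (2 <= k)%nat) (a : nat -> C)
    (U : C -> Prop) (hU : open (T := C_UniformSpace) U)
    (hQU : forall t : C, U t -> monic_poly k a t <> RtoC 0)
    (gamma : cycle)
    (hgamma : locally_constant_cycle k (monic_poly k a) U gamma) :
  forall t : C, U t ->
    (forall n : nat, (n <= k)%nat -> C_ex_derive_n (cycle_integral gamma) n t) /\
    Lop k (monic_poly k a) (cycle_integral gamma) t = RtoC 0.
Proof.
intros t ht.
destruct (ladder_cycle k a U gamma ltac:(lia) hU hgamma) as (J & h1 & h2 & h3).
assert (hd := fun n => C_derive_n_ladder k U _ J n hU h1 h2 t ht).
assert (ha := alpha_pos k hk).
split.
- intros [|n] _; [exact I|]. eexists. exact (proj2 (hd n)).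
- change (Lop k (monic_poly k a) (cycle_integral gamma) t) with
    (csum (fun j => RtoC (INR (k + 1 - j) / (INR (fact j) * pochhammer (alpha k) (k - j)))
       * C_derive_n (monic_poly k a) j t * C_derive_n (cycle_integral gamma) (k - j) t) k).
  assert (ha0 : RtoC (alpha k) <> 0) by (intros e; apply RtoC_inj in e; lra).
  (* The ladder carries the extra factor $-\alpha$ of the exact form; it is divided out, and the
     boundary term of a cycle is zero. *)
  transitivity (- / RtoC (alpha k) * csum (fun j => - RtoC (alpha k)
    * lop_weight k (monic_poly k a) t j * J (k - j)%nat t) k).
  + rewrite <- csum_mult. apply csum_ext. intros j hj.
    rewrite (proj1 (hd (k - j)%nat)). unfold lop_weight, taylor_coeff.
    assert (hp := pochhammer_pos (alpha k) (k - j) ha).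
    assert (hp0 : RtoC (pochhammer (alpha k) (k - j)) <> 0)
      by (intros e; apply RtoC_inj in e; lra).
    assert (hf := INR_fact_neq_0 j). assert (hf0 := INR_fact_neq0_C j).
    rewrite RtoC_div, RtoC_mult by (apply Rmult_integral_contrapositive; split; lra).
    field. auto.
  + rewrite (h3 t ht). ring.
Qed.
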